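(* Let $k,m,n$ be positive integers with $k\le m\le n$. The expected value $E_k(A)$ of the minimum $k$-assignment of a random exponential $m\times n$ matrix with rate matrix $A=(a_{ij})$, regarded as a function of the positive $m\times n$ matrix $A$, is a rational function of the entries $a_{ij}$ of $A$. The denominator of this rational function is a product of sums (repetitions allowed), each sum being the sum of all entries in a submatrix of $A$ obtained by omitting $i$ rows and $j$ columns, where $i+j<k$.
   Context: A $k$-assignment of an $m\times n$ matrix $X$ is a set of $k$ entries of $X$, no two in the same row or column; $\min_k(X)$ denotes the minimum possible sum of the entries of a $k$-assignment. A real random variable is exponentially distributed with rate $a>0$ if it has density $ae^{-ax}$, $x\ge 0$. For a matrix $A=(a_{ij})$ with positive entries, a random exponential matrix with rate matrix $A$ is a random matrix $X=(x_{ij})$ whose entries are independent, with $x_{ij}$ exponentially distributed with rate $a_{ij}$. $E_k(A)$ denotes the expected value of $\min_k(X)$ for such an $X$. *)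

(* Defs.v *)
From HB Require Import structures.
From mathcomp Require Import all_boot all_order all_algebra.
From mathcomp Require Import all_classical all_reals all_analysis.
(* Not imported: the notations of mpoly clash with those of MathComp-Analysis. *)
From mathcomp Require mpoly.

Set Implicit Arguments.
Unset Strict Implicit.
Unset Printing Implicit Defensive.

Import Order.TTheory GRing.Theory Num.Theory.
Local Open Scope classical_set_scope.
Local Open Scope ring_scope.

(* An assignment is given by the positions of its entries. *)
Definition is_assignment (m n k : nat) (S : {set 'I_m * 'I_n}) : bool :=
  (#|S| == k) &&
  [forall p in S, forall q in S, (p != q) ==> (p.1 != q.1) && (p.2 != q.2)].

Definition cost (R : realType) (m n : nat) (X : 'M[R]_(m, n))
    (S : {set 'I_m * 'I_n}) : R :=
  \sum_(p in S) X p.1 p.2.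

(* [finset.set0] is only the default returned by [arg min] when there is no
   k-assignment, i.e. when k > m or k > n; see [min_assignmentP]. *)
Definition min_assignment (R : realType) (m n k : nat) (X : 'M[R]_(m, n)) : R :=
  cost X [arg min_(S < finset.set0 | is_assignment k S) cost X S]%O.

Lemma exists_assignment (m n k : nat) : (k <= m)%N -> (k <= n)%N ->
  exists S : {set 'I_m * 'I_n}, is_assignment k S.
Proof.
move=> km kn.
pose f (i : 'I_k) := (widen_ord km i, widen_ord kn i).
have fI : injective f by move=> i j [] /val_inj.
exists (f @: 'I_k); apply/andP; split.
  by rewrite card_imset // card_ord.
apply/forall_inP => _ /imsetP[i _ ->]; apply/forall_inP => _ /imsetP[j _ ->].
apply/implyP => fij.
have ij : i != j by apply: contra_neq fij => ->.
by apply/andP; split; apply: contra_neq ij => -[] /val_inj.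
Qed.

Lemma min_assignmentP (R : realType) (m n k : nat) (X : 'M[R]_(m, n)) :
  (k <= m)%N -> (k <= n)%N ->
  (exists2 S, is_assignment k S & min_assignment k X = cost X S) /\
  (forall S, is_assignment k S -> min_assignment k X <= cost X S).
Proof.
move=> km kn; have [S0 S0k] := exists_assignment km kn.
have [S1 S1k S1min] := arg_minP (cost X) S0k.
rewrite /min_assignment /Order.arg_min /extremum; case: pickP => [S|noS] /=.
  by case/andP => Sk /forall_inP Smin; split; [exists S | exact: Smin].
have := noS S1; rewrite /= S1k /= => /negP[]; apply/forall_inP; exact: S1min.
Qed.

Definition mutually_independent (d : measure_display) (T : measurableType d)
    (R : realType) (P : probability T R) (I : finType)
    (X : I -> {RV P >-> R}) : Prop :=
  forall (J : {set I}) (B : I -> set R), (forall i, measurable (B i)) ->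
    P (\bigcap_(i in [set` J]) (X i @^-1` B i)) =
    (\prod_(i in J) P (X i @^-1` B i))%E.

(* For r > 0, [exponential_prob r] is the probability measure with density
   r e^{-rx} on [0, +oo[. *)
Definition exponentially_distributed (d : measure_display)
    (T : measurableType d) (R : realType) (P : probability T R) (r : R)
    (X : {RV P >-> R}) : Prop :=
  forall B : set R, measurable B -> distribution P X B = exponential_prob r B.

Definition random_exponential_matrix (d : measure_display)
    (T : measurableType d) (R : realType) (P : probability T R) (m n : nat)
    (A : 'M[R]_(m, n)) (X : 'I_m -> 'I_n -> {RV P >-> R}) : Prop :=
  mutually_independent (fun p : 'I_m * 'I_n => X p.1 p.2) /\
  (forall i j, exponentially_distributed (A i j) (X i j)).

Definition submatrix_sum (R : realType) (m n : nat) (A : 'M[R]_(m, n))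
    (I : {set 'I_m}) (J : {set 'I_n}) : R :=
  \sum_(i in ~: I) \sum_(j in ~: J) A i j.

(* The m * n indeterminates stand for the entries of A in the order of
   [mxvec]. *)
Definition eval_entries (R : realType) (m n : nat)
    (N : mpoly.mpoly (m * n) R) (A : 'M[R]_(m, n)) : R :=
  mpoly.meval (fun l => mxvec A ord0 l) N.

(* Main.v *)
(** For lines (I, J) with |I| + |J| < k let 1_C be the indicator of the entries
outside the rows I and the columns J.  Every k-assignment meets C in at least
k - |I| - |J| entries, and by max-flow min-cut and Birkhoff's theorem min_k(x)
is the maximum of sum t_C (k - |I| - |J|) over the decompositions
x = sum t_C 1_C + sum y_l e_l with nonnegative coefficients.  After a generic
perturbation of the objective, almost every x lies in exactly one simplicial
cone spanned by an optimal basis of vectors 1_C and e_l, and min_k is linear on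
that cone.  By memorylessness, conditionally on X lying in the cone spanned by
v_1, ..., v_N, its coordinates there are independent exponential variables of
rates <a, v_i>; an exponential change of density shows that the cone has
probability proportional to prod a_l / prod <a, v_i>.  The factors
<a, e_l> = a_l cancel, and the factors <a, 1_C> are submatrix sums. *)

Require Import Defs.
From mathcomp Require Import all_boot all_order all_algebra ring lra zify.
Set Implicit Arguments.
Unset Strict Implicit.
Unset Printing Implicit Defensive.
Import Order.TTheory GRing.Theory Num.Theory.
Local Open Scope ring_scope.

(** * Perfect matchings and doubly stochastic matrices *)

(** The factor of proportionality of a cone is [|det (gens V g)|], by a linear change of variables
    in the integral of the density. No integral over N-dimensional space is computed here: laws are
    handled through their values on orthants, and it is enough that the factor depends neither on
    the rates nor on the probability space, which follows from comparing any two exponential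
    vectors. A rate [<a, v_i>] with [v_i = e_l] is a single entry, in general not an allowed
    denominator. It occurs in the probability of the cone, where it cancels, and in the mean of the
    corresponding coordinate, which has weight 0 in the objective. The perturbed objective only
    selects the cones. Its optimal bases remain optimal for the original weights, so the value of
    min_k on a cone is computed with the unperturbed ones. Optimal bases and flows are taken as
    maximisers over finite or compact sets, so no algorithm has to be shown to terminate. *)

Lemma hall (T U : finType) (u0 : U) (r : T -> {set U}) (D : {set T}) :
  (forall A : {set T}, A \subset D -> (#|A| <= #|\bigcup_(a in A) r a|)%N) ->
  exists2 f : T -> U, {in D &, injective f} & {in D, forall a, f a \in r a}.
Proof.
have [N] := ubnP #|D|; elim: N => // N IH in r D *; rewrite ltnS => DN hallD.
(* Either a proper nonempty tight set splits the problem into two smaller ones, or every such set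
   has a neighbour to spare and one pair may be matched freely. *)
case: (boolP [exists A : {set T}, [&& A \proper D, A != set0 &
    #|\bigcup_(a in A) r a| == #|A|]]) => [/existsP[A]|].
  case/and3P => AD A0 /eqP tightA.
  have subAD := proper_sub AD.
  have [||f1 f1I f1r] := IH r A.
  - by apply: leq_trans DN; exact: proper_card.
  - by move=> B BA; apply: hallD; exact: subset_trans BA subAD.
  pose NA := \bigcup_(a in A) r a.
  have [||f2 f2I f2r] := IH (fun a => r a :\: NA) (D :\: A).
  - apply: leq_trans DN; apply: proper_card; apply/properP; split.
      exact: subsetDl.
    case/set0Pn: A0 => a aA; exists a; first exact: (subsetP subAD).
    by rewrite inE aA.
  - move=> B /subsetDP[BD BA].
    have -> : \bigcup_(a in B) (r a :\: NA) = (\bigcup_(a in B) r a) :\: NA.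
      apply/setP => u; rewrite inE; apply/bigcupP/andP.
        case=> a aB; rewrite inE => /andP[uNA ur]; split => //.
        by apply/bigcupP; exists a.
      by case=> uNA /bigcupP[a aB ur]; exists a => //; rewrite inE uNA.
    (* Hall's condition for [A :|: B], minus the tight equality for [A], is Hall's condition for [B]
       outside [NA]. *)
    have := hallD (A :|: B); rewrite subUset subAD BD => /(_ isT).
    rewrite bigcup_setU cardsU.
    have -> : A :&: B = set0 by rewrite setIC; exact: disjoint_setI0.
    rewrite cards0 subn0 cardsU tightA => AB.
    by rewrite cardsD setIC -/NA; move: AB; rewrite -/NA; lia.
  exists (fun a => if a \in A then f1 a else f2 a).
    have f12 a b : a \in A -> b \in D -> b \notin A -> f1 a != f2 b.
      move=> aA bD bA; apply/eqP => f12; have := f2r b.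
      rewrite !inE bA bD => /(_ isT) /andP[/bigcupP[]]; exists a => //.
      by rewrite -f12 f1r.
    move=> a b aD bD; case: ifPn => aA; case: ifPn => bA //.
    - exact: f1I.
    - by move/eqP; rewrite (negPf (f12 _ _ aA bD bA)).
    - by move/esym/eqP; rewrite (negPf (f12 _ _ bA aD aA)).
    - by apply: f2I; rewrite inE ?aA ?bA.
  move=> a aD; case: ifPn => aA; first exact: f1r.
  by have := f2r a; rewrite !inE aA aD => /(_ isT) /andP[].
rewrite negb_exists => /forallP noTight.
have [->|[a aD]] := set_0Vmem D; first by exists (fun=> u0) => a; rewrite inE.
have [u ua] : exists u, u \in r a.
  apply/set0Pn; rewrite -card_gt0.
  by have := hallD [set a]; rewrite sub1set aD cards1 big_set1; apply.
have [||f fI fr] := IH (fun b => r b :\ u) (D :\ a).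
- by apply: leq_trans DN; rewrite (cardsD1 a D) aD.
- move=> B BDa; have [->|B0] := eqVneq B set0; first by rewrite cards0.
  have BD : B \subset D by apply: subset_trans BDa _; exact: subD1set.
  have := noTight B; rewrite B0 /= properEneq BD.
  have -> /= : B != D.
    by apply: contraTneq BDa => ->; apply/subsetPn; exists a => //; rewrite !inE eqxx.
  move/negP => tight; have := hallD B BD; rewrite leq_eqVlt => /orP[/eqP e|].
    by case: tight; rewrite e.
  have -> : \bigcup_(b in B) (r b :\ u) = (\bigcup_(b in B) r b) :\ u.
    apply/setP => v; rewrite !inE; apply/bigcupP/andP.
      by case=> b bB; rewrite !inE => /andP[vu vr]; split => //; apply/bigcupP; exists b.
    by case=> vu /bigcupP[b bB vr]; exists b => //; rewrite !inE vu.
  by rewrite (cardsD1 u (\bigcup_(b in B) r b)); case: (u \in _) => /=; lia.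
exists (fun b => if b == a then u else f b).
  have fu b : b \in D -> b != a -> f b != u.
    by move=> bD ba; have := fr b; rewrite !inE ba bD => /(_ isT) /andP[].
  move=> b c bD cD; case: eqVneq => [->|ba]; case: eqVneq => [->|ca] //.
  - by move/esym/eqP; rewrite (negPf (fu _ cD ca)).
  - by move/eqP; rewrite (negPf (fu _ bD ba)).
  - by apply: fI; rewrite !inE ?ba ?ca.
move=> b bD; case: eqVneq => [-> //|ba].
by have := fr b; rewrite !inE ba bD => /(_ isT) /andP[].
Qed.

(** Permutations are peeled off [M] one by one, which is why the common line sum [s] is arbitrary.
    The bound [z] is asked only of permutations inside the support of [M], so that a zero block of
    [M] restricts the permutations to be considered. *)
Lemma birkhoff_bound (R : realFieldType) (T U : finType) (M c : T -> U -> R)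
    (s z : R) : (0 < #|T|)%N -> #|T| = #|U| ->
  0 <= s -> (forall i j, 0 <= M i j) ->
  (forall i, \sum_j M i j = s) -> (forall j, \sum_i M i j = s) ->
  (forall f : T -> U, bijective f -> (forall i, 0 < M i (f i)) ->
    z <= \sum_i c i (f i)) ->
  s * z <= \sum_i \sum_j M i j * c i j.
Proof.
move=> T_gt0 cardTU.
have /card_gt0P[u0 _] : (0 < #|U|)%N by rewrite -cardTU.
have /card_gt0P[t0 _] := T_gt0.
have [N] := ubnP #|[set x : T * U | M x.1 x.2 != 0]|.
elim: N => // N IH in M s *; rewrite ltnS => suppN s0 M0 rowM colM zc.
have [se0|sn0] := eqVneq s 0.
  rewrite se0 mul0r big1 // => i _; rewrite big1 // => j _.
  have /eqP := rowM i; rewrite se0 psumr_eq0 // => /allP /(_ j).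
  by rewrite mem_index_enum => /(_ isT)/= /eqP ->; rewrite mul0r.
have sgt0 : 0 < s by rewrite lt_def sn0.
have [|f fI fM] := @hall T U u0 (fun i => [set j | 0 < M i j]) [set: T].
  (* The rows in [A] carry mass [s * #|A|], all of it in the columns [NA], which hold only
     [s * #|NA|]. *)
  move=> A _; set NA := \bigcup_(_ in _) _.
  rewrite -(ler_nat R) -(ler_pM2r sgt0) !mulr_natl -!sumr_const.
  apply: (@le_trans _ _ (\sum_(i in A) \sum_(j in NA) M i j)).
    apply: ler_sum => i iA; rewrite -(rowM i) [leRHS]big_mkcond /=.
    apply: ler_sum => j _; case: ifPn => // /bigcupP jNA.
    by rewrite leNgt; apply/negP => Mij; apply: jNA; exists i; rewrite ?inE.
  rewrite exchange_big; apply: ler_sum => j _.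
  by rewrite -(colM j) big_mkcond; apply: ler_sum => i _; case: ifP.
have {}fI : injective f by move=> i j; apply: fI; rewrite inE.
have {}fM i : 0 < M i (f i) by have := fM i; rewrite !inE; apply.
have fB : bijective f by apply: inj_card_bij; rewrite // cardTU.
have [g fK gK] := fB.
(* Subtracting the smallest entry along [f] keeps the matrix nonnegative and makes one more entry
   vanish. *)
pose i0 := [arg min_(i < t0) M i (f i)]%O.
have i0min i : M i0 (f i0) <= M i (f i).
  by rewrite /i0; case: arg_minP => // j _; apply.
pose e := M i0 (f i0).
pose M' i j := M i j - e * (f i == j)%:R.
have M'0 i j : 0 <= M' i j.
  rewrite /M' subr_ge0; case: eqVneq => [<-|_]; last by rewrite mulr0.
  by rewrite mulr1; exact: i0min.
have rowM' i : \sum_j M' i j = s - e.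
  rewrite sumrB rowM -mulr_sumr (bigD1 (f i)) //= eqxx big1 ?addr0 ?mulr1 //.
  by move=> j /negPf; rewrite eq_sym => ->.
have colM' j : \sum_i M' i j = s - e.
  rewrite sumrB colM -mulr_sumr (bigD1 (g j)) //= gK eqxx big1 ?addr0 ?mulr1 //.
  by move=> i ij; case: eqVneq => // fij; rewrite -fij fK eqxx in ij.
have se0 : 0 <= s - e by rewrite -(rowM' t0); apply: sumr_ge0.
have : (s - e) * z <= \sum_i \sum_j M' i j * c i j.
  apply: IH => //.
    apply: leq_trans suppN; apply: proper_card; apply/properP; split.
      apply/subsetP => -[i j]; rewrite !inE /=; apply: contraNN => /eqP Mij.
      rewrite /M' Mij sub0r oppr_eq0 mulf_eq0; case: (eqVneq (f i) j) => [fij|]; last first.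
        by rewrite eqxx orbT.
      by have := fM i; rewrite fij Mij ltxx.
    exists (i0, f i0); rewrite !inE /=; first by rewrite gt_eqF.
    by rewrite negbK /M' /e eqxx mulr1 subrr.
  move=> h hB hM; apply: zc => // i; apply: lt_le_trans (hM i) _.
  by rewrite /M' gerBl mulr_ge0 ?ler0n // ltW // /e.
have zf := zc f fB fM.
have -> : \sum_i \sum_j M' i j * c i j =
    \sum_i \sum_j M i j * c i j - e * \sum_i c i (f i).
  rewrite mulr_sumr -sumrB; apply: eq_bigr => i _.
  rewrite (eq_bigr (fun j => M i j * c i j - e * ((f i == j)%:R * c i j))).
    rewrite sumrB -mulr_sumr [X in _ - _ * X](bigD1 (f i)) //= eqxx mul1r.
    rewrite [X in c _ _ + X]big1 ?addr0 // => j /negPf.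
    by rewrite eq_sym => ->; rewrite mul0r.
  by move=> j _; rewrite /M' mulrBl mulrA.
have e0 : 0 <= e by rewrite ltW // /e.
have := ler_wpM2l e0 zf; nra.
Qed.

(** * Simplicial cones of optimal bases *)

Lemma small_scalar (R : realFieldType) (K : finType) (a b : K -> R) :
  (forall l, 0 <= a l) -> (forall l, 0 < b l) ->
  exists2 e, 0 < e & forall l, e * a l < b l.
Proof.
move=> a0 b0; pose s := 1 + \sum_l a l / b l.
have ab l : 0 <= a l / b l by rewrite divr_ge0 // ltW.
have s0 : 0 < s by rewrite ltr_pwDl ?ltr01 // sumr_ge0.
exists s^-1; first by rewrite invr_gt0.
move=> l; rewrite mulrC ltr_pdivrMr // mulrC -ltr_pdivrMr // /s (bigD1 l) //=.
have : 0 <= \sum_(i | i != l) a i / b i by exact: sumr_ge0.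
lra.
Qed.

(** The hyperplanes are left one at a time by moving a single coordinate, so little that forms
    already nonzero stay nonzero and positive ones stay positive. *)
Lemma perturb_off_hyperplanes (R : realFieldType) (K J : finType)
    (phi : K -> J -> R) (w : J -> R) :
  exists w' : J -> R,
    (forall l, (exists a, phi l a != 0) -> \sum_a phi l a * w' a != 0) /\
    (forall l, \sum_a phi l a * w' a < 0 -> \sum_a phi l a * w a <= 0).
Proof.
pose lin l (u : J -> R) := \sum_a phi l a * u a.
suff [w' w'0 w's] : exists2 w' : J -> R,
    (forall l, l \in enum K -> (exists a, phi l a != 0) -> lin l w' != 0) &
    (forall l, 0 < lin l w -> 0 < lin l w').
  exists w'; split => [l|l]; first by apply: w'0; rewrite mem_enum.
  by move=> neg; rewrite leNgt; apply/negP => /w's; rewrite ltNge (ltW neg).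
elim: (enum K) => [|l ls [w' w'0 w's]]; first by exists w => // l; rewrite in_nil.
have [l0|ln0] := eqVneq (lin l w') 0; last first.
  exists w' => // l'; rewrite inE => /orP[/eqP -> //|]; exact: w'0.
have [/existsP[a pa]|no] := boolP [exists a, phi l a != 0]; last first.
  exists w' => // l'; rewrite inE => /orP[/eqP -> [a pa]|]; last exact: w'0.
  by case/negP: no; apply/existsP; exists a.
(* A form vanishing at [w'] has no sign to preserve; 1 is then a dummy bound. *)
have [||e e0 eP] := @small_scalar _ _ (fun l' => `|phi l' a|)
    (fun l' => if lin l' w' == 0 then 1 else `|lin l' w'|).
- by move=> l'; exact: normr_ge0.
- by move=> l'; case: eqVneq => // ?; rewrite normr_gt0.
pose w'' b := w' b + e * (b == a)%:R.
have linE l' : lin l' w'' = lin l' w' + e * phi l' a.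
  rewrite /lin (eq_bigr (fun b => phi l' b * w' b + e * (phi l' b * (b == a)%:R))).
    rewrite big_split /= -mulr_sumr; congr (_ + _ * _).
    by rewrite (bigD1 a) //= eqxx mulr1 big1 ?addr0 // => b /negPf ->; rewrite mulr0.
  by move=> b _; rewrite /w'' mulrDr mulrCA.
have small l' : lin l' w' != 0 -> e * `|phi l' a| < `|lin l' w'|.
  by move=> /negPf l'0; have := eP l'; rewrite l'0.
exists w'' => l'.
  rewrite inE linE => /orP[/eqP -> _|l'ls l'a].
    by rewrite l0 add0r mulf_neq0 // gt_eqF.
  have := small _ (w'0 l' l'ls l'a); rewrite -[X in X * _](gtr0_norm e0) -normrM.
  by apply: contraTneq => /eqP; rewrite addr_eq0 => /eqP ->; rewrite normrN ltxx.
move=> /w's l'0; rewrite linE; have := small l' (lt0r_neq0 l'0).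
rewrite -[X in X * _](gtr0_norm e0) -normrM (gtr0_norm l'0).
rewrite ltr_norml => /andP[]; lra.
Qed.

Section cones.
Variables (R : realFieldType) (N : nat) (J : finType) (V : J -> 'rV[R]_N).
Implicit Types (g h : {ffun 'I_N -> J}) (x y : 'rV[R]_N) (w : J -> R).

Definition gens g : 'M[R]_N := \matrix_i V (g i).
Definition coords g x : 'rV[R]_N := x *m invmx (gens g).
Definition in_cone g x := [forall i, 0 < coords g x ord0 i].
(* The dual solution of the basis [g] in the linear program: maximise
   [sum_a t a * w a] subject to [x = sum_a t a *: V a] and [t >= 0]. *)
Definition lp w g x : R := \sum_i coords g x ord0 i * w (g i).
(** Primal nondegeneracy: a tie in the ratio test of a pivot would give a zero coordinate in the new
    basis. *)
Definition generic x := forall g, gens g \in unitmx -> forall i, coords g x ord0 i != 0.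

Lemma gens_sum g (c : 'rV[R]_N) : c *m gens g = \sum_i c ord0 i *: V (g i).
Proof. by rewrite mulmx_sum_row; apply: eq_bigr => i _; rewrite rowK. Qed.

Lemma coordsK g x : gens g \in unitmx -> coords g x *m gens g = x.
Proof. by move=> gu; rewrite mulmxKV. Qed.

Lemma coords_uniq g x c : gens g \in unitmx -> c *m gens g = x -> coords g x = c.
Proof. by move=> gu <-; rewrite /coords mulmxK. Qed.

Lemma coords_gen g i : gens g \in unitmx -> coords g (V (g i)) = delta_mx ord0 i.
Proof.
move=> gu; apply: coords_uniq => //; rewrite -rowE.
by apply/rowP => l; rewrite !mxE.
Qed.

Lemma lpE w g x : lp w g x = (x *m (invmx (gens g) *m \col_i w (g i))) ord0 ord0.
Proof. by rewrite mulmxA mxE; apply: eq_bigr => i _; congr (_ * _); rewrite mxE. Qed.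

Lemma lp_sum w g (I : finType) (c : I -> R) (y : I -> 'rV[R]_N) :
  lp w g (\sum_i c i *: y i) = \sum_i c i * lp w g (y i).
Proof.
rewrite lpE mulmx_suml summxE; apply: eq_bigr => i _.
by rewrite lpE -scalemxAl mxE.
Qed.

Lemma lp_gen w g i : gens g \in unitmx -> lp w g (V (g i)) = w (g i).
Proof.
move=> gu; rewrite /lp coords_gen // (bigD1 i) //= mxE !eqxx mul1r big1 ?addr0 //.
by move=> j /negPf ji; rewrite mxE ji andbF mul0r.
Qed.

Lemma gens_inj g : gens g \in unitmx -> injective g.
Proof.
move=> gu i j gij; have := coords_gen i gu; rewrite gij coords_gen //.
move/rowP/(_ j); rewrite !mxE !eqxx /=; case: eqVneq => // _ /eqP.
by rewrite oner_eq0.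
Qed.

Definition image_of g : {set J} := [set g i | i : 'I_N].

(** A basis is an ordered family, so one cone has many names [g]; its coordinates merely get
    permuted. *)
Lemma same_image g h : gens g \in unitmx -> gens h \in unitmx ->
  image_of g = image_of h ->
  exists2 s : 'I_N -> 'I_N, injective s &
    forall x i, h i = g (s i) /\ coords h x ord0 i = coords g x ord0 (s i).
Proof.
move=> gu hu gh.
have /fin_all_exists[s sP] i : exists j, h i = g j.
  have : h i \in image_of g by rewrite gh; apply/imsetP; exists i.
  by case/imsetP => j _ ->; exists j.
have sI : injective s.
  by move=> i j sij; apply: (gens_inj hu); rewrite !sP sij.
exists s => // x i; split => //.
rewrite (@coords_uniq h x (\row_i coords g x ord0 (s i))) ?mxE //.
rewrite gens_sum -[RHS](coordsK x gu) gens_sum [RHS](reindex_inj sI) /=.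
by apply: eq_bigr => j _; rewrite mxE sP.
Qed.

Lemma in_cone_same_image g h x : gens g \in unitmx -> gens h \in unitmx ->
  image_of g = image_of h -> in_cone g x -> in_cone h x.
Proof.
move=> gu hu gh /forallP gx; have [s _ sP] := same_image gu hu gh.
by apply/forallP => i; have [_ ->] := sP x i.
Qed.

Lemma lp_same_image w g h x : gens g \in unitmx -> gens h \in unitmx ->
  image_of g = image_of h -> lp w g x = lp w h x.
Proof.
move=> gu hu gh; have [s sI sP] := same_image gu hu gh.
rewrite /lp [LHS](reindex_inj sI) /=; apply: eq_bigr => i _.
by have [-> ->] := sP x i.
Qed.

(** Strictness off the basis is dual nondegeneracy. It forces two such bases whose cones meet to
    have the same generators. *)
Definition dual_feasible w g :=
  [forall a, (a \notin image_of g) ==> (w a < lp w g (V a))].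

Lemma dual_feasible_le w g a : gens g \in unitmx -> dual_feasible w g ->
  w a <= lp w g (V a).
Proof.
move=> gu /forallP/(_ a); case: (boolP (a \in image_of g)) => [|_ /ltW //].
by case/imsetP => i _ -> _; rewrite lp_gen.
Qed.

(** Weak duality with complementary slackness: after expanding [x] in the basis [h], the two values
    are compared term by term, and a term is tight only for a generator of [g]. *)
Lemma lp_value_le w g h x : gens g \in unitmx -> gens h \in unitmx ->
  dual_feasible w g -> in_cone h x ->
  lp w h x <= lp w g x ?= iff (image_of h \subset image_of g).
Proof.
move=> gu hu gd /forallP hx.
have -> : lp w g x = \sum_i coords h x ord0 i * lp w g (V (h i)).
  by rewrite -{1}(coordsK x hu) gens_sum lp_sum.
have le i : coords h x ord0 i * w (h i) <= coords h x ord0 i * lp w g (V (h i))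
    ?= iff (h i \in image_of g).
  split; first by rewrite ler_wpM2l ?dual_feasible_le // ltW.
  have /gt_eqF c0 := hx i; rewrite (inj_eq (mulfI _)) ?c0 //.
  apply/eqP/idP => [e|/imsetP[j _ ->]]; last by rewrite lp_gen.
  apply/negPn/negP => hg; have := forallP gd (h i); rewrite hg /= -e.
  by rewrite ltxx.
have [l e] := leif_sum (fun i (_ : true) => le i).
split => //; rewrite e; apply/forallP/subsetP => [H a /imsetP[i _ ->]|H i].
  exact: H.
by apply: H; apply/imsetP; exists i.
Qed.

Lemma cone_unique w g h x : gens g \in unitmx -> gens h \in unitmx ->
  dual_feasible w g -> dual_feasible w h -> in_cone g x -> in_cone h x ->
  image_of g = image_of h.
Proof.
move=> gu hu gd hd gx hx.
have [l1 e1] := lp_value_le gu hu gd hx.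
have [l2 e2] := lp_value_le hu gu hd gx.
have e : lp w h x = lp w g x by apply/eqP; rewrite eq_le l1 l2.
apply/eqP; rewrite eqEsubset -e1 -e2 e eqxx //.
Qed.

Hypothesis V_ge0 : forall a l, 0 <= V a ord0 l.
Hypothesis V_neq0 : forall a, V a != 0.
Variable unit_gen : 'I_N -> J.
Hypothesis unit_genE : forall l, V (unit_gen l) = delta_mx ord0 l.

(* A feasible basis of maximal value is dual feasible: otherwise one pivot of
   the simplex method increases the value. *)
Lemma cone_exists w x :
  (forall g a, gens g \in unitmx -> a \notin image_of g -> w a != lp w g (V a)) ->
  (forall l, 0 < x ord0 l) -> generic x ->
  exists g, [/\ gens g \in unitmx, in_cone g x & dual_feasible w g].
Proof.
move=> w_gen x0 x_gen.
pose feas g := (gens g \in unitmx) && in_cone g x.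
pose g0 := [ffun l => unit_gen l].
have g0E : gens g0 = 1%:M.
  by apply/row_matrixP => i; rewrite rowK ffunE unit_genE row1.
have g0f : feas g0.
  rewrite /feas g0E unitmx1 /=; apply/forallP => i.
  by rewrite /coords g0E invmx1 mulmx1.
have [g /andP[gu gx] gmax] := Order.TotalTheory.arg_maxP (fun g => lp w g x) g0f.
exists g; split => //; apply/forallP => a; apply/implyP => ag.
rewrite ltNge le_eqVlt; apply/negP => /orP[/eqP e|red].
  by have := w_gen g a gu ag; rewrite e eqxx.
pose t := coords g x; pose c := coords g (V a).
have t0 i : 0 < t ord0 i by exact: (forallP gx).
(* Otherwise [V a] would be a nonpositive combination of nonnegative vectors, hence 0; this is where
   boundedness of the linear program enters. *)
have [i1 ci1] : exists i, 0 < c ord0 i.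
  apply/existsP; apply: contraNT (V_neq0 a); rewrite negb_exists => /forallP c0.
  apply/eqP/rowP => l; apply/eqP; rewrite mxE eq_le V_ge0 andbT.
  rewrite -(coordsK (V a) gu) gens_sum summxE; apply: sumr_le0 => i _.
  by rewrite mxE; apply: mulr_le0_ge0 => //; rewrite leNgt c0.
(* Ratio test: the generator that leaves is the first whose coordinate reaches 0 as the weight of
   [a] grows. *)
have [i ci imin] :=
  @Order.TotalTheory.arg_minP _ R 'I_N i1 (fun i => 0 < c ord0 i) (fun i => t ord0 i / c ord0 i) ci1.
pose e := t ord0 i / c ord0 i.
have e0 : 0 < e by rewrite divr_gt0.
pose g' : {ffun 'I_N -> J} := [ffun j => if j == i then a else g j].
pose t' : 'rV[R]_N := \row_j if j == i then e else t ord0 j - e * c ord0 j.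
have g'E (d : 'rV[R]_N) : d *m gens g' =
    (\row_j (d ord0 i * c ord0 j + (j != i)%:R * d ord0 j)) *m gens g.
  rewrite !gens_sum (bigD1 i) //= ffunE eqxx -{1}(coordsK (V a) gu) gens_sum.
  rewrite scaler_sumr.
  under [RHS]eq_bigr do rewrite mxE scalerDl -scalerA.
  rewrite big_split /=; congr (_ + _).
  rewrite [RHS](bigD1 i) //= eqxx mul0r scale0r add0r.
  by apply: eq_bigr => j ji; rewrite ffunE (negPf ji) mul1r.
have g'u : gens g' \in unitmx.
  rewrite -row_free_unit; apply: inj_row_free => d; rewrite g'E => d0.
  have {d0} /rowP d0 := coords_uniq gu d0; rewrite /coords mul0mx in d0.
  have dE j : d ord0 i * c ord0 j + (j != i)%:R * d ord0 j = 0.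
    by have := d0 j; rewrite mxE [RHS]mxE.
  have di : d ord0 i = 0.
    have /eqP := dE i; rewrite eqxx mul0r addr0 mulf_eq0 (gt_eqF ci) orbF.
    by move/eqP.
  apply/rowP => j; rewrite mxE; have := dE j; rewrite di mul0r add0r.
  by case: eqVneq => [-> _|_] //; rewrite mul1r.
have t'E : t' *m gens g' = x.
  rewrite g'E -[RHS](coordsK x gu); congr (_ *m _); apply/rowP => j.
  rewrite [LHS]mxE ![t' _ _]mxE eqxx; case: eqVneq => [->|ji] /=.
    by rewrite mul0r addr0 /e divfK // gt_eqF.
  by rewrite mul1r addrC subrK.
have t'x := coords_uniq g'u t'E.
have g'x : in_cone g' x.
  apply/forallP => j; rewrite lt_def x_gen //= t'x mxE; case: eqVneq => [_|ji].
    exact: ltW.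
  rewrite subr_ge0; have [cj|cj] := leP (c ord0 j) 0.
    by apply: (@le_trans _ _ 0); rewrite ?(ltW (t0 j)) // mulr_ge0_le0 // ltW.
  by rewrite -ler_pdivlMr //; exact: imin.
have := gmax g'; rewrite /feas g'u g'x => /(_ isT) /=; rewrite leNgt => /negP; apply.
have -> : lp w g' x = lp w g x + e * (w a - lp w g (V a)).
  rewrite /lp t'x -/t -/c (bigD1 i) //= [in RHS](bigD1 i) //=.
  rewrite [X in _ - X](bigD1 i) //= mxE eqxx ffunE eqxx.
  rewrite (eq_bigr (fun j => t ord0 j * w (g j) - e * (c ord0 j * w (g j)))); last first.
    by move=> j ji; rewrite mxE ffunE (negPf ji) mulrBl mulrA.
  rewrite sumrB -mulr_sumr.
  have te : t ord0 i = e * c ord0 i by rewrite /e divfK // gt_eqF.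
  rewrite te; ring.
by rewrite ltrDl mulr_gt0 // subr_gt0.
Qed.

(** Existence and uniqueness of the cone hold for a perturbed objective [w']. The perturbation never
    reverses a strict sign of a reduced cost, so the selected bases satisfy the weak inequalities
    for [w] itself. *)
Lemma cone_partition w : exists C : {set {ffun 'I_N -> J}},
  (forall g, g \in C -> gens g \in unitmx /\ forall a, w a <= lp w g (V a)) /\
  (forall x, (forall l, 0 < x ord0 l) -> generic x ->
    exists2 g, g \in C /\ in_cone g x & forall h, h \in C -> in_cone h x -> h = g).
Proof.
(* The reduced cost of [a] at the basis [g], as a linear form in the objective; off the basis its
   coefficient at [a] is 1, so the form is not zero. *)
pose phi (ga : {ffun 'I_N -> J} * J) b : R := (b == ga.2)%:R -
  \sum_i coords ga.1 (V ga.2) ord0 i * (b == ga.1 i)%:R.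
have linE g a u : \sum_b phi (g, a) b * u b = u a - lp u g (V a).
  rewrite /phi /=; under eq_bigr do rewrite mulrBl mulr_suml.
  rewrite sumrB exchange_big /=; congr (_ - _).
    by rewrite (bigD1 a) //= eqxx mul1r big1 ?addr0 // => b /negPf ->; rewrite mul0r.
  apply: eq_bigr => i _; rewrite (bigD1 (g i)) //= eqxx mulr1 big1 ?addr0 //.
  by move=> b /negPf ->; rewrite mulr0 mul0r.
have [w' [w'0 w'w]] := perturb_off_hyperplanes phi w.
(* One ordering is chosen for each set of generators, so that every cone is counted once. *)
pose rep g := odflt g [pick h | (gens h \in unitmx) && (image_of h == image_of g)].
have repP g : gens g \in unitmx ->
    [/\ gens (rep g) \in unitmx, image_of (rep g) = image_of g & rep (rep g) = rep g].
  move=> gu; have [ru rE] : gens (rep g) \in unitmx /\ image_of (rep g) = image_of g.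
    rewrite /rep; case: pickP => [h /andP[hu /eqP hE] //|/(_ g)].
    by rewrite gu eqxx.
  split => //; rewrite {1}/rep rE [in RHS]/rep; case: pickP => // /(_ g).
  by rewrite gu eqxx.
exists [set g | [&& gens g \in unitmx, dual_feasible w' g & rep g == g]]; split.
  move=> g; rewrite inE => /and3P[gu gd _]; split => // a.
  case: (boolP (a \in image_of g)) => [/imsetP[i _ ->]|ag]; first by rewrite lp_gen.
  rewrite -subr_le0 -linE; apply: w'w; rewrite linE subr_lt0.
  by have /forallP/(_ a) := gd; rewrite ag.
have w'g g a : gens g \in unitmx -> a \notin image_of g -> w' a != lp w' g (V a).
  move=> gu ag; rewrite -subr_eq0 -linE; apply: w'0; exists a.
  rewrite /phi /= eqxx big1 ?subr0 ?oner_eq0 // => i _.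
  by case: eqVneq => [agi|]; [case/imsetP: ag; exists i|rewrite mulr0].
move=> x x0 xg; have [g [gu gx gd]] := cone_exists w'g x0 xg.
have [ru rE rr] := repP g gu.
have rd : dual_feasible w' (rep g).
  apply/forallP => a; rewrite rE -(lp_same_image w' (V a) gu ru (esym rE)).
  exact: (forallP gd).
exists (rep g).
  split; first by rewrite inE ru rd rr eqxx.
  exact: (in_cone_same_image gu ru (esym rE)).
move=> h; rewrite inE => /and3P[hu hd /eqP hr] hx; rewrite -hr [LHS]/rep.
rewrite (cone_unique hu gu hd gd hx gx) /rep.
by case: pickP => // /(_ g); rewrite gu eqxx.
Qed.

End cones.

From mathcomp Require Import all_classical all_reals all_analysis.
From mathcomp Require Import measurable_realfun.
From mathcomp Require mpoly.
Import (canonicals) mpoly.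
Import Order.TTheory GRing.Theory Num.Theory numFieldNormedType.Exports.
Local Open Scope classical_set_scope.
Local Open Scope ring_scope.

(** * Maximal flows *)

Lemma continuous_sumr (R : realType) (T : topologicalType) (I : Type)
    (r : seq I) (F : I -> T -> R) :
  (forall i, continuous (F i)) -> continuous (fun v => \sum_(i <- r) F i v).
Proof.
move=> cF; elim: r => [|i r IH].
  by under eq_fun do rewrite big_nil; exact: cst_continuous.
under eq_fun do rewrite big_cons.
by move=> v; apply: continuousD; [exact: cF|exact: IH].
Qed.

(** A flow from rows to columns in the bipartite network with capacity 1 at each row and column and
    capacity [p i j] on the edge from i to j. *)
Definition subflow (R : realType) (m n : nat) (p q : 'M[R]_(m, n)) :=
  [/\ forall i j, 0 <= q i j <= p i j, forall i, \sum_j q i j <= 1 &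
      forall j, \sum_i q i j <= 1].

Definition flow_value (R : realType) (m n : nat) (q : 'M[R]_(m, n)) :=
  \sum_i \sum_j q i j.

Definition max_subflow (R : realType) (m n : nat) (p q : 'M[R]_(m, n)) :=
  subflow p q /\ forall q', subflow p q' -> flow_value q' <= flow_value q.

Lemma max_subflow_exists (R : realType) (m n : nat) (p : 'M[R]_(m, n)) :
  (forall i j, 0 <= p i j) -> exists q, max_subflow p q.
Proof.
move=> p0.
pose box := [set v : 'rV[R]_(m * n) | forall l, `[0, mxvec p ord0 l]%classic (v ord0 l)].
pose rowc := [set v : 'rV[R]_(m * n) |
  forall i, \sum_j v ord0 (mxvec_index i j) <= 1].
pose colc := [set v : 'rV[R]_(m * n) |
  forall j, \sum_i v ord0 (mxvec_index i j) <= 1].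
have ccoord l : continuous (fun v : 'rV[R]_(m * n) => v ord0 l).
  exact: coord_continuous.
have closedF (I : Type) (F : I -> 'rV[R]_(m * n) -> R) :
    (forall i, continuous (F i)) -> closed [set v | forall i, F i v <= 1].
  move=> cF; have -> : [set v | forall i, F i v <= 1] =
      \bigcap_(i in [set: I]) F i @^-1` [set x | x <= 1].
    by apply/seteqP; split => v /= Fv; [move=> i _; exact: Fv|move=> i; exact: Fv].
  apply: closed_bigI => i _; move/continuous_closedP: (cF i); apply.
  exact: closed_le.
have compA : compact ((box `&` rowc) `&` colc)%classic.
  apply: compact_closedI.
    apply: compact_closedI; first exact: (rV_compact (fun l => @segment_compact _ _ _)).
    by apply: closedF => i; apply: continuous_sumr => j; exact: ccoord.
  by apply: closedF => i; apply: continuous_sumr => j; exact: ccoord.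
have AE v : ((box `&` rowc) `&` colc)%classic v <-> subflow p (vec_mx v).
  split.
    case=> -[vb vr] vc; split.
    - move=> i j; rewrite mxE; have /= := vb (mxvec_index i j).
      by rewrite in_itv /= mxvecE.
    - by move=> i; under eq_bigr do rewrite mxE; exact: vr.
    - by move=> i; under eq_bigr do rewrite mxE; exact: vc.
  case=> vb vr vc; split; first split.
  - move=> l /=; case/mxvec_indexP: l => i j; rewrite in_itv /= mxvecE.
    by have := vb i j; rewrite mxE.
  - by move=> i; have := vr i; under eq_bigr do rewrite mxE.
  - by move=> i; have := vc i; under eq_bigr do rewrite mxE.
have A0 : ((box `&` rowc) `&` colc !=set0)%classic.
  exists 0; apply/AE; rewrite linear0; split.
  - by move=> i j; rewrite mxE lexx p0.
  - by move=> i; rewrite big1 // => j _; rewrite mxE.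
  - by move=> i; rewrite big1 // => j _; rewrite mxE.
have ctot : continuous (fun v : 'rV[R]_(m * n) => flow_value (vec_mx v)).
  rewrite /flow_value; apply: continuous_sumr => i; apply: continuous_sumr => j.
  by under eq_fun do rewrite mxE; exact: ccoord.
have [v vA vmax] := compact_EVT_max A0 compA (continuous_subspaceT ctot).
exists (vec_mx v); split; first by apply/AE; rewrite inE in vA.
move=> q' q'A; have := vmax (mxvec q'); rewrite mxvecK; apply.
by rewrite inE; apply/AE; rewrite mxvecK.
Qed.

Section perturbation.
Variables (R : realType) (m n : nat).
Implicit Types (q p : 'M[R]_(m, n)).

Lemma row_delta i j i0 : \sum_j0 (delta_mx i j : 'M[R]_(m, n)) i0 j0 = (i0 == i)%:R.
Proof.
rewrite (bigD1 j) //= !mxE eqxx andbT big1 ?addr0 // => j0 /negPf j0j.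
by rewrite mxE j0j andbF.
Qed.

Lemma col_delta i j j0 : \sum_i0 (delta_mx i j : 'M[R]_(m, n)) i0 j0 = (j0 == j)%:R.
Proof.
rewrite (bigD1 i) //= !mxE eqxx big1 ?addr0 // => i0 /negPf i0i.
by rewrite mxE i0i.
Qed.

Lemma row_addZ q q' (a : R) i :
  \sum_j (q + a *: q') i j = \sum_j q i j + a * \sum_j q' i j.
Proof. by rewrite mulr_sumr -big_split; apply: eq_bigr => j _; rewrite !mxE. Qed.

Lemma col_addZ q q' (a : R) j :
  \sum_i (q + a *: q') i j = \sum_i q i j + a * \sum_i q' i j.
Proof. by rewrite mulr_sumr -big_split; apply: eq_bigr => i _; rewrite !mxE. Qed.

Lemma flow_value_addZ q q' (a : R) : flow_value (q + a *: q') = flow_value q + a * flow_value q'.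
Proof.
by rewrite mulr_sumr -big_split; apply: eq_bigr => i _; rewrite row_addZ.
Qed.

Lemma flow_value_delta i j : flow_value (delta_mx i j : 'M[R]_(m, n)) = 1.
Proof.
rewrite /flow_value; under eq_bigr do rewrite row_delta.
by rewrite (bigD1 i) //= eqxx big1 ?addr0 // => i0 /negPf ->.
Qed.

Lemma subflow_avg p (q : 'I_m -> 'M[R]_(m, n)) : (0 < m)%N ->
  (forall i, subflow p (q i)) -> subflow p (m%:R^-1 *: \sum_i q i).
Proof.
move=> m0 qP; have m0R : 0 < m%:R :> R by rewrite ltr0n.
have avg (F : 'I_m -> R) c : (forall i, F i <= c) -> m%:R^-1 * \sum_i F i <= c.
  move=> Fc; rewrite mulrC ler_pdivrMr //.
  apply: (@le_trans _ _ (\sum_(i < m) c)); first by apply: ler_sum.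
  by rewrite sumr_const card_ord mulr_natr lexx.
have E i j : (m%:R^-1 *: \sum_i q i) i j = m%:R^-1 * \sum_i0 q i0 i j.
  by rewrite mxE summxE.
split=> [i j|i|j].
- rewrite E; apply/andP; split.
    apply: mulr_ge0; first by rewrite invr_ge0 ltW.
    by apply: sumr_ge0 => l _; case: (qP l) => /(_ i j)/andP[].
  by apply: avg => l; case: (qP l) => /(_ i j)/andP[].
- under eq_bigr do rewrite E; rewrite -mulr_sumr exchange_big /=.
  by apply: avg => l; case: (qP l).
- under eq_bigr do rewrite E; rewrite -mulr_sumr exchange_big /=.
  by apply: avg => l; case: (qP l).
Qed.

(* Averaging one maximizer per row gives a maximizer in which a row is slack as
   soon as it is slack in some maximizer. *)
Lemma slackest_max_subflow p : (0 < m)%N -> (forall i j, 0 <= p i j) ->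
  exists2 q, max_subflow p q &
    forall q' i, max_subflow p q' -> \sum_j q' i j < 1 -> \sum_j q i j < 1.
Proof.
move=> m0 p0; have [c cmax] := max_subflow_exists p0.
have m0R : 0 < m%:R :> R by rewrite ltr0n.
have /fin_all_exists[q qP] (i : 'I_m) : exists qi, max_subflow p qi /\
    forall q', max_subflow p q' -> \sum_j q' i j < 1 -> \sum_j qi i j < 1.
  have [[q' [q'm q'1]]|no] := pselect (exists q', max_subflow p q' /\ \sum_j q' i j < 1).
    by exists q'.
  by exists c; split => // q' q'm q'1; case: no; exists q'.
have E (i : 'I_m) j : (m%:R^-1 *: \sum_i q i) i j = m%:R^-1 * \sum_i0 q i0 i j.
  by rewrite mxE summxE.
have totq i : flow_value (q i) = flow_value c.
  have [[qim1 qim2] _] := qP i; by apply/eqP; rewrite eq_le (proj2 cmax _ qim1) qim2 //; exact: (proj1 cmax).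
exists (m%:R^-1 *: \sum_i q i).
  split; first by apply: subflow_avg => // i; case: (qP i) => -[].
  move=> q' q's; apply: (le_trans (proj2 cmax _ q's)).
  rewrite [leRHS]/flow_value; under eq_bigr do under eq_bigr do rewrite E.
  under eq_bigr do rewrite -mulr_sumr exchange_big /=.
  rewrite -mulr_sumr exchange_big /= mulrC ler_pdivlMr //.
  rewrite mulr_natr -[X in _ *+ X](card_ord m) -sumr_const.
  by apply: ler_sum => i _; rewrite -(totq i).
move=> q' i q'm q'1.
under eq_bigr do rewrite E; rewrite -mulr_sumr exchange_big /= mulrC.
rewrite ltr_pdivrMr // mul1r (bigD1 i) //=.
have -> : m%:R = 1 + (\sum_(l < m | l != i) 1) :> R.
  have -> : m%:R = \sum_(l < m) 1 :> R by rewrite sumr_const card_ord.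
  by rewrite (bigD1 i).
apply: ltr_leD; first by case: (qP i) => _; apply; eassumption.
by apply: ler_sum => l _; case: (qP l) => -[[]].
Qed.

(* In the slackest maximal flow, shifting mass along a column shows that no flow
   enters the saturated columns [J] from the saturated rows [~: B]. *)
Lemma max_flow_min_cut (k : nat) p : (0 < m)%N -> (forall i j, 0 <= p i j) ->
  (forall (I : {set 'I_m}) (J : {set 'I_n}), (#|I| + #|J| < k)%N ->
    (k - (#|I| + #|J|))%:R <= submatrix_sum p I J) ->
  exists2 q, subflow p q & k%:R <= flow_value q.
Proof.
move=> m0 p0 cut; have [q [qs qmax] slack] := slackest_max_subflow m0 p0.
exists q => //; have [qp q1 qc1] := qs.
pose B := [set i | \sum_j q i j < 1]%SET.
pose J := [set j | [exists i in B, q i j < p i j]]%SET.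
have q0 i j : 0 <= q i j by case/andP: (qp i j).
have qle i j : q i j <= p i j by case/andP: (qp i j).
(* If a column of [J] had room, [e] more units could be sent from a slack row through it, against
   maximality. *)
have Jsat j : j \in J -> \sum_i q i j = 1.
  rewrite inE => /existsP[i /andP[]]; rewrite inE => iB qij.
  apply/eqP; rewrite eq_le qc1 /= leNgt; apply/negP => cj.
  pose e := Num.min (p i j - q i j)
    (Num.min (1 - \sum_j q i j) (1 - \sum_i q i j)).
  have e0 : 0 < e by rewrite !lt_min !subr_gt0 qij iB cj.
  have [e1 e2 e3] : [/\ e <= p i j - q i j, e <= 1 - \sum_j q i j &
      e <= 1 - \sum_i q i j].
    by split; rewrite !ge_min lexx ?orbT.
  have := qmax (q + e *: delta_mx i j).
  rewrite flow_value_addZ flow_value_delta mulr1 => H.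
  suff /H : subflow p (q + e *: delta_mx i j) by lra.
  split.
  - move=> a b; rewrite !mxE; case: (eqVneq a i) => [->|_] /=; last first.
      by rewrite mulr0 addr0.
    case: (eqVneq b j) => [->|_] /=; last by rewrite mulr0 addr0.
    by have ? := q0 i j; apply/andP; split; lra.
  - move=> a; rewrite row_addZ row_delta; have := q1 a.
    by case: (eqVneq a i) => [->|_] /=; lra.
  - move=> a; rewrite col_addZ col_delta; have := qc1 a.
    by case: (eqVneq a j) => [->|_] /=; lra.
have reach i i' j : i \in B -> q i j < p i j -> 0 < q i' j -> i' \in B.
  move=> iB qij qi'j; have [-> //|ii'] := eqVneq i' i.
  move: (iB); rewrite !inE => iB1.
  pose e := Num.min (p i j - q i j)
    (Num.min (1 - \sum_j q i j) (q i' j)).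
  have e0 : 0 < e by rewrite !lt_min !subr_gt0 qij iB1.
  have [e1 e2 e3] : [/\ e <= p i j - q i j, e <= 1 - \sum_j q i j & e <= q i' j].
    by split; rewrite !ge_min lexx ?orbT.
  (* Rerouting inside column j keeps the value and makes row i' slack in a maximal flow, hence slack
     in [q] by the choice of [q]. *)
  pose q' := q + e *: delta_mx i j + (- e) *: delta_mx i' j.
  apply: (slack q').
    split.
      split.
      - move=> a b; rewrite !mxE.
        case: (eqVneq b j) => [->|_] /=; last first.
          by rewrite !andbF !mulr0 !addr0; exact: qp.
        case: (eqVneq a i) => [->|_] /=; rewrite ?andbT.
          by rewrite eq_sym (negPf ii') /= mulr0 mulr1; have ? := q0 i j; apply/andP; split; lra.
        case: (eqVneq a i') => [->|_] /=; rewrite ?mulr0 ?mulr1 ?addr0; last exact: qp.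
        by have ? := qle i' j; apply/andP; split; lra.
      - move=> a; rewrite !row_addZ !row_delta; have := q1 a.
        case: (eqVneq a i) => [->|_] /=.
          by rewrite eq_sym (negPf ii') /=; lra.
        by case: (eqVneq a i') => _ /=; lra.
      - move=> a; rewrite !col_addZ !col_delta; have := qc1 a; lra.
    move=> q2 /qmax; rewrite !flow_value_addZ !flow_value_delta; lra.
  rewrite !row_addZ !row_delta eqxx (negPf ii') /=; have := q1 i'; lra.
(* The flow equals the capacity of a cut: rows outside [B] are full, columns in [J] are full and fed
   from [B] alone, and the remaining edges are saturated. *)
have tot : flow_value q = #|~: B|%:R + #|J|%:R + submatrix_sum p (~: B) J.
  rewrite /flow_value (bigID (mem (~: B))) /= -addrA; congr (_ + _).
    rewrite -sumr_const; apply: eq_bigr => i; rewrite !inE -leNgt => i1.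
    by apply/eqP; rewrite eq_le q1.
  rewrite /submatrix_sum finset.setCK -sumr_const.
  rewrite (eq_bigl (mem B)); last by move=> i; rewrite /= finset.in_setC negbK.
  under eq_bigr do rewrite (bigID (mem J)) /=.
  rewrite big_split /= exchange_big /=; congr (_ + _).
    apply: eq_bigr => j jJ; rewrite -(Jsat j jJ) [RHS](bigID (mem B)) /=.
    rewrite [X in _ = _ + X]big1 ?addr0 // => i iB.
    apply/eqP; rewrite eq_le q0 andbT leNgt; apply: contra iB => qij.
    move: jJ; rewrite inE => /existsP[i' /andP[i'B i'j]].
    exact: (reach i' i j).
  apply: eq_bigr => i iB; apply: eq_big => [j|j jJ]; first by rewrite finset.in_setC.
  apply/eqP; rewrite eq_le qle /= leNgt; apply: contra jJ => qij.
  by rewrite inE; apply/existsP; exists i; rewrite iB.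
(* The hypothesis speaks of fewer than k lines; a cut with at least k lines has capacity at least k
   by its lines alone. *)
rewrite tot -natrD; have [lt_k|ge_k] := ltnP (#|~: B| + #|J|) k.
  have := cut _ _ lt_k; rewrite natrB ?(ltnW lt_k) //; lra.
apply: (@le_trans _ _ (#|~: B| + #|J|)%:R); first by rewrite ler_nat.
rewrite lerDl /submatrix_sum; apply: sumr_ge0 => i _; exact: sumr_ge0.
Qed.

End perturbation.

(* A fractional k-assignment extends to a doubly stochastic matrix with n - k
   extra rows and m - k extra columns. *)
Lemma fractional_assignment_bound (R : realType) (m n k : nat)
    (q x : 'M[R]_(m, n)) (z : R) : (0 < m)%N -> (k <= m)%N -> (k <= n)%N ->
  (forall i j, 0 <= q i j) -> (forall i, \sum_j q i j <= 1) ->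
  (forall j, \sum_i q i j <= 1) -> flow_value q = k%:R ->
  (forall S, is_assignment k S -> z <= cost x S) ->
  z <= \sum_i \sum_j q i j * x i j.
Proof.
move=> m0 km kn q0 q1 qc1 qk zS.
pose T := ('I_m + 'I_(n - k))%type; pose U := ('I_n + 'I_(m - k))%type.
(* The deficit of each row is spread evenly over the extra columns, and that of each column over the
   extra rows. *)
pose rdef i := (1 - \sum_j q i j) / (m - k)%:R.
pose cdef j := (1 - \sum_i q i j) / (n - k)%:R.
pose M (t : T) (u : U) := match t, u with
  | inl i, inl j => q i j | inl i, inr _ => rdef i
  | inr _, inl j => cdef j | inr _, inr _ => 0 end.
pose c (t : T) (u : U) := match t, u with
  | inl i, inl j => x i j | _, _ => 0 end.
(* For [l = k] the quotient by 0 is 0, and the identity survives because a total of k then forces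
   every [F i] to be 1. *)
have sumdef (l : nat) (F : 'I_l -> R) : (k <= l)%N -> \sum_i F i = k%:R ->
    (forall i, F i <= 1) ->
    (forall i, F i + (l - k)%:R * ((1 - F i) / (l - k)%:R) = 1).
  move=> kl Fk F1 i; have [lk|lk] := eqVneq (l - k)%N 0%N; last first.
    by rewrite mulrC divfK ?pnatr_eq0 // addrC subrK.
  rewrite lk mul0r addr0; apply/eqP; rewrite -subr_eq0 -oppr_eq0 opprB.
  have : \sum_i (1 - F i) == 0.
    rewrite sumrB Fk sumr_const card_ord subr_eq0 eqr_nat; lia.
  rewrite psumr_eq0; last by move=> j _; rewrite subr_ge0.
  by move=> /allP/(_ i); rewrite mem_index_enum => /(_ isT).
have sumdef1 (l : nat) (F : 'I_l -> R) (b : 'I_(l - k)) : \sum_i F i = k%:R ->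
    \sum_i ((1 - F i) / (l - k)%:R) = 1.
  move=> Fk; have lk : (0 < l - k)%N by case: (l - k)%N b => [[]|].
  rewrite -mulr_suml sumrB Fk sumr_const card_ord -natrB; last by lia.
  by rewrite divff // pnatr_eq0 -lt0n.
have qk' : \sum_j \sum_i q i j = k%:R by rewrite exchange_big.
have := @birkhoff_bound R T U M c 1 z; rewrite mul1r.
have -> : \sum_i \sum_j M i j * c i j = \sum_i \sum_j q i j * x i j.
  rewrite big_sumType /= [X in _ + X]big1 ?addr0 => [|b _]; last first.
    by rewrite big_sumType /= !big1 ?addr0 // => j _; rewrite mulr0.
  apply: eq_bigr => i _; rewrite big_sumType /= [X in _ + X]big1 ?addr0 // => j _.
  by rewrite mulr0.
apply.
- by rewrite card_sum card_ord; lia.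
- by rewrite !card_sum !card_ord; lia.
- exact: ler01.
- by case=> [i|b] [j|b'] //=; rewrite divr_ge0 ?ler0n // subr_ge0.
- case=> [i|b]; rewrite big_sumType /=.
    rewrite sumr_const card_ord -[_ *+ _]mulr_natl.
    exact: (sumdef _ (fun i => \sum_j q i j)).
  rewrite [X in _ + X]big1 // addr0.
  exact: (sumdef1 _ (fun j => \sum_i q i j)).
- case=> [j|b]; rewrite big_sumType /=.
    rewrite sumr_const card_ord -[_ *+ _]mulr_natl.
    exact: (sumdef _ (fun j => \sum_i q i j)).
  rewrite [X in _ + X]big1 // addr0.
  exact: (sumdef1 _ (fun i => \sum_j q i j)).
move=> f fB fM; have fI := bij_inj fB.
pose col i := if f (inl i) is inl j then Some j else None.
pose S := [set p : 'I_m * 'I_n | f (inl p.1) == inl p.2]%SET.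
have cS : cost x S = \sum_i c i (f i).
  rewrite /cost big_sumType /= [X in _ = _ + X]big1 ?addr0; last first.
    by move=> b _; rewrite /c.
  transitivity (\sum_i \sum_j if (i, j) \in S then x i j else 0).
    by rewrite pair_bigA big_mkcond; apply: eq_bigr => -[].
  apply: eq_bigr => i _.
  rewrite -big_mkcond /=; case fi : (f (inl i)) => [j|b] /=.
    rewrite (bigD1 j) ?inE ?fi //= big1 ?addr0 // => j'.
    by rewrite inE /= fi => /andP[/eqP[->]]; rewrite eqxx.
  by rewrite big1 // => j; rewrite inE /= fi.
rewrite -cS; apply: zS; apply/andP; split; last first.
  apply/forall_inP => -[i j]; rewrite inE /= => /eqP fi.
  apply/forall_inP => -[i' j']; rewrite inE /= => /eqP fi'.
  apply/implyP; rewrite xpair_eqE negb_and => ij.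
  case: (eqVneq i i') ij fi => [-> |ii'] /= ij fi.
    by move: fi fi' ij => -> [->]; rewrite eqxx.
  by apply: contra_neq ii' => jj'; have [] : inl i = inl i' :> T by apply: fI; rewrite fi fi' jj'.
pose A := [set i | if f (inl i) is inl _ then true else false]%SET.
have -> : #|S| = #|A|.
  rewrite -(@card_in_imset _ _ fst S).
    apply: eq_card => i; rewrite inE; apply/imsetP/idP.
      by case=> -[i' j]; rewrite inE /= => /eqP fi ->; rewrite fi.
    case fi : (f (inl i)) => [j|] // _; exists (i, j) => //.
    by rewrite inE /= fi.
  case=> [i j] [i' j'] /=; rewrite !inE /= => /eqP fi /eqP fi' ii'.
  by move: fi; rewrite ii' fi' => -[->].
(* [f] stays in the support of [M], which has a zero corner, so each of the [m - k] extra columns is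
   matched to a genuine row. Exactly k rows remain for genuine columns. *)
have Ac : #|~: A|%SET = (m - k)%N.
  rewrite -[RHS]card_ord -(card_imset _ (@inr_inj 'I_n 'I_(m - k))).
  rewrite -(on_card_preimset (f := f)); last exact: onW_bij.
  rewrite -(card_imset _ (@inl_inj 'I_m 'I_(n - k))).
  apply: eq_card => t; apply/imsetP/idP.
    case=> i; rewrite !inE => fi ->; case E : (f (inl i)) fi => [//|b] _.
    by apply/imsetP; exists b.
  rewrite inE => /imsetP[b _]; case: t => [i|a] fE.
    by exists i => //; rewrite !inE fE.
  by have := fM (inr a); rewrite fE /= ltxx.
have := cardsC A; rewrite card_ord Ac; lia.
Qed.

(** By max-flow min-cut [p] dominates a fractional k-assignment, obtained by scaling a flow of value
    at least k down to exactly k; as [x] is nonnegative, passing from it to [p] only increases the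
    sum. *)
Lemma min_assignment_le_cut (R : realType) (m n k : nat) (p x : 'M[R]_(m, n)) :
  (0 < k)%N -> (k <= m)%N -> (k <= n)%N ->
  (forall i j, 0 <= p i j) -> (forall i j, 0 <= x i j) ->
  (forall (I : {set 'I_m}) (J : {set 'I_n}), (#|I| + #|J| < k)%N ->
    (k - (#|I| + #|J|))%:R <= submatrix_sum p I J) ->
  min_assignment k x <= \sum_i \sum_j p i j * x i j.
Proof.
move=> k0 km kn p0 x0 cut; have m0 : (0 < m)%N by exact: leq_trans km.
have [q [qp q1 qc1] qk] := max_flow_min_cut m0 p0 cut.
have k0R : 0 < k%:R :> R by rewrite ltr0n.
have v0 : 0 < flow_value q by exact: lt_le_trans qk.
pose a := k%:R / flow_value q.
have a0 : 0 <= a by rewrite divr_ge0 // ltW.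
have a1 : a <= 1 by rewrite ler_pdivrMr // mul1r.
have q0 i j : 0 <= q i j by case/andP: (qp i j).
have sub1 (b : R) : 0 <= b -> b <= 1 -> a * b <= 1.
  move=> b0 b1; rewrite -[leRHS]mulr1; exact: ler_pM.
apply: (@le_trans _ _ (\sum_i \sum_j (a *: q) i j * x i j)).
  apply: (@fractional_assignment_bound _ _ _ k) => //.
  - by move=> i j; rewrite mxE mulr_ge0.
  - move=> i; under eq_bigr do rewrite mxE.
    by rewrite -mulr_sumr sub1 // sumr_ge0.
  - move=> j; under eq_bigr do rewrite mxE.
    by rewrite -mulr_sumr sub1 // sumr_ge0.
  - rewrite /flow_value; under eq_bigr do under eq_bigr do rewrite mxE.
    under eq_bigr do rewrite -mulr_sumr.
    by rewrite -mulr_sumr -/(flow_value q) /a divfK // gt_eqF.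
  - by move=> S SA; apply: (proj2 (min_assignmentP x km kn)).
apply: ler_sum => i _; apply: ler_sum => j _; apply: ler_wpM2r => //.
rewrite mxE; case/andP: (qp i j) => _; apply: le_trans.
by rewrite -[leRHS]mul1r ler_wpM2r.
Qed.

Definition submatrix_mask (R : realType) (m n : nat) (I : {set 'I_m})
  (J : {set 'I_n}) : 'M[R]_(m, n) :=
  \matrix_(i, j) ((i \notin I) && (j \notin J))%:R.

(** Each omitted line contains at most one entry of the assignment, and an entry lost to both a row
    and a column is counted twice. *)
Lemma cost_submatrix_mask (R : realType) (m n k : nat) (I : {set 'I_m})
    (J : {set 'I_n}) (S : {set 'I_m * 'I_n}) : is_assignment k S ->
  (k - (#|I| + #|J|))%:R <= cost (submatrix_mask R I J) S.
Proof.
case/andP => /eqP Sk /forall_inP SA.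
pose SI := [set p in S | p.1 \in I]%SET.
pose SJ := [set p in S | p.2 \in J]%SET.
have disj p p' : p \in S -> p' \in S -> p.1 = p'.1 \/ p.2 = p'.2 -> p = p'.
  move=> pS p'S e; apply: contraPeq e => pp'.
  have /forall_inP/(_ p' p'S) := SA p pS; rewrite pp' => /andP[/eqP ? /eqP ?].
  by case.
have cI : (#|SI| <= #|I|)%N.
  rewrite -(@card_in_imset _ _ fst SI).
    apply: subset_leq_card; apply/fintype.subsetP => i /imsetP[p].
    by rewrite inE => /andP[_ pI] ->.
  move=> p p'; rewrite !inE => /andP[pS _] /andP[p'S _] e.
  by apply: disj => //; left.
have cJ : (#|SJ| <= #|J|)%N.
  rewrite -(@card_in_imset _ _ snd SJ).
    apply: subset_leq_card; apply/fintype.subsetP => i /imsetP[p].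
    by rewrite inE => /andP[_ pI] ->.
  move=> p p'; rewrite !inE => /andP[pS _] /andP[p'S _] e.
  by apply: disj => //; right.
have -> : cost (submatrix_mask R I J) S = #|S :\: (SI :|: SJ)|%SET%:R.
  rewrite /cost -sumr_const [LHS]big_mkcond [RHS]big_mkcond.
  apply: eq_bigr => p _; rewrite !inE mxE.
  by case: (p \in S); rewrite /= ?andbF // negb_or andbT; case: andb.
rewrite ler_nat cardsD Sk.
have : (#|S :&: (SI :|: SJ)| <= #|SI| + #|SJ|)%N.
  apply: leq_trans (leq_card_setU _ _).
  exact: subset_leq_card (finset.subsetIr _ _).
lia.
Qed.

(** * Exponential vectors *)

Lemma measurable_forall d (T : measurableType d) (I : finType)
    (F : I -> T -> Prop) : (forall i, measurable [set w | F i w]) ->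
  measurable [set w | forall i, F i w].
Proof.
move=> mF; have -> : [set w | forall i, F i w] = \bigcap_(i in [set: I]) [set w | F i w].
  by apply/seteqP; split => w /= Fw; [move=> i _; exact: Fw|move=> i; exact: Fw].
exact: fin_bigcap_measurable.
Qed.

Section orthants.
Variables (R : realType) (N : nat).

Definition orthant (s : 'rV[R]_N) : set 'rV[R]_N :=
  [set x | forall i, s ord0 i < x ord0 i].

Definition orthants : set (set 'rV[R]_N) := [set orthant s | s in [set: 'rV[R]_N]].

(** Orthants are the events whose probability is known; with the sigma-algebra they generate, a
    finite law is determined by them and its total mass. *)
Definition vecT := g_sigma_algebraType orthants.

Lemma setI_closed_orthants : setI_closed orthants.
Proof.
move=> _ _ [s _ <-] [t _ <-].
exists (\row_i Num.max (s ord0 i) (t ord0 i)) => //; apply/seteqP; split => x /=.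
  by move=> H; split => i; have := H i; rewrite mxE gt_max => /andP[].
by case=> H1 H2 i; rewrite mxE gt_max H1 H2.
Qed.

Lemma measurable_coord (i : 'I_N) :
  measurable_fun [set: vecT] (fun x : vecT => (x : 'rV[R]_N) ord0 i).
Proof.
apply: (measurability _ (RGenOInfty.measurableE R)).
move=> _ [_ [r ->] <-]; rewrite setTI.
(* A half-space is the union of orthants whose other bounds tend to minus infinity. *)
have -> : (fun x : vecT => (x : 'rV[R]_N) ord0 i) @^-1` `]r, +oo[%classic =
    \bigcup_k orthant (\row_j if j == i then r else - k%:R).
  apply/seteqP; split => x /=.
    rewrite in_itv /= andbT => rx.
    pose k := Num.bound (\sum_j `|(x : 'rV[R]_N) ord0 j|).
    exists k => // j; rewrite mxE; case: eqVneq => [-> //|ji].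
    have := archi_boundP (_ : 0 <= \sum_j `|(x : 'rV[R]_N) ord0 j|).
    rewrite sumr_ge0 // => /(_ isT); rewrite -/k (bigD1 j) //= => kx.
    rewrite ltrNl; apply: le_lt_trans kx.
    apply: (@le_trans _ _ `|(x : 'rV[R]_N) ord0 j|).
      by rewrite -normrN ler_norm.
    by rewrite lerDl sumr_ge0.
  by case=> k _ /(_ i); rewrite mxE eqxx in_itv /= andbT.
apply: bigcupT_measurable => k; apply: sub_sigma_algebra.
by eexists.
Qed.

Lemma measurable_vec d (T : measurableType d) (X : T -> 'rV[R]_N) :
  (forall i, measurable_fun setT (fun w => X w ord0 i)) ->
  measurable_fun setT (X : T -> vecT).
Proof.
move=> mX; apply: (@measurability _ _ T vecT _ _ orthants) => //.
move=> _ [_ [s _ <-] <-]; rewrite setTI.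
apply: measurable_forall => i.
have -> : [set w | s ord0 i < X w ord0 i] =
    (fun w => X w ord0 i) @^-1` `]s ord0 i, +oo[%classic.
  by apply/seteqP; split => w /=; rewrite in_itv /= andbT.
rewrite -[X in measurable X]setTI; exact: mX.
Qed.

End orthants.

Section mass.
Variables (R : realType) (N : nat).

(* The general shape (restricted domain, density [G], map [X]) covers a shifted
   vector as well as an exponentially tilted one. *)
Definition mass d (T : measurableType d) (mu : {measure set T -> \bar R})
  (D : set T) (G : T -> R) (X : T -> 'rV[R]_N) (E : set 'rV[R]_N) : \bar R :=
  (\int[mu]_(w in D `&` X @^-1` E) (G w)%:E)%E.

Variables (d1 d2 : measure_display) (T1 : measurableType d1)
  (T2 : measurableType d2) (mu1 : {measure set T1 -> \bar R})
  (mu2 : {measure set T2 -> \bar R}).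
Variables (D1 : set T1) (D2 : set T2) (G1 : T1 -> R) (G2 : T2 -> R)
  (X1 : T1 -> 'rV[R]_N) (X2 : T2 -> 'rV[R]_N).

(** Dynkin's argument on the pi-system of orthants. The whole space is not among the orthants when N
    is positive, so equality of the total masses is a separate hypothesis; finiteness allows
    complements to be taken by subtraction. *)
Lemma mass_unique :
  measurable D1 -> measurable D2 ->
  measurable_fun setT G1 -> measurable_fun setT G2 ->
  (forall w, 0 <= G1 w) -> (forall w, 0 <= G2 w) ->
  measurable_fun setT (X1 : T1 -> vecT R N) ->
  measurable_fun setT (X2 : T2 -> vecT R N) ->
  (mass mu1 D1 G1 X1 setT < +oo)%E ->
  mass mu1 D1 G1 X1 setT = mass mu2 D2 G2 X2 setT ->
  (forall s, mass mu1 D1 G1 X1 (orthant s) = mass mu2 D2 G2 X2 (orthant s)) ->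
  forall E : set (vecT R N), measurable E ->
    mass mu1 D1 G1 X1 E = mass mu2 D2 G2 X2 E.
Proof.
move=> mD1 mD2 mG1 mG2 G10 G20 mX1 mX2 finT eqT eqO E mE.
have mI d (T : measurableType d) (D : set T) (X : T -> vecT R N) (S : set (vecT R N)) :
    measurable D -> measurable_fun setT X -> measurable S ->
    measurable (D `&` X @^-1` S).
  by move=> mD mX mS; apply: measurableI => //; rewrite -[X in measurable X]setTI; exact: mX.
have massC d (T : measurableType d) (mu : {measure set T -> \bar R}) (D : set T) (G : T -> R)
    (X : T -> vecT R N) (S : set (vecT R N)) :
    measurable D -> measurable_fun setT G -> (forall w, 0 <= G w) ->
    measurable_fun setT X -> measurable S ->
    mass mu D G X setT = (mass mu D G X S + mass mu D G X (~` S))%E.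
  move=> mD mG G0 mX mS; rewrite /mass -ge0_integral_setU.
  - by rewrite -setIUr -preimage_setU setUv.
  - exact: mI.
  - by apply: mI => //; exact: measurableC.
  - exact/measurable_EFinP/(measurable_funS measurableT).
  - by move=> w _; rewrite lee_fin.
  - by apply/disj_setPS => w /= -[[_ ?] [_ ?]].
have massU d (T : measurableType d) (mu : {measure set T -> \bar R}) (D : set T) (G : T -> R)
    (X : T -> vecT R N) (F : (set (vecT R N))^nat) :
    measurable D -> measurable_fun setT G -> (forall w, 0 <= G w) ->
    measurable_fun setT X -> (forall n, measurable (F n)) -> trivIset setT F ->
    mass mu D G X (\bigcup_n F n) = (\sum_(n <oo) mass mu D G X (F n))%E.
  move=> mD mG G0 mX mF tF; rewrite /mass preimage_bigcup setI_bigcupr.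
  rewrite ge0_integral_bigcup //.
  - by move=> n; exact: mI.
  - exact/measurable_EFinP/(measurable_funS measurableT).
  - by move=> w _; rewrite lee_fin.
  - move/trivIsetP: tF => tF; apply/trivIsetP => i j _ _ ij.
    rewrite -subset0 => w /= -[[_ wi] [_ wj]].
    by have := tF i j I I ij; rewrite -subset0 => /(_ (X w)); apply.
apply: (@dynkin_induction _ (vecT R N) (@orthants R N)
  (fun S => mass mu1 D1 G1 X1 S = mass mu2 D2 G2 X2 S)) => //.
- exact: setI_closed_orthants.
- by move=> _ [s _ <-]; exact: eqO.
- move=> S mS eS; have := massC _ _ mu1 D1 G1 X1 S mD1 mG1 G10 mX1 mS.
  have := massC _ _ mu2 D2 G2 X2 S mD2 mG2 G20 mX2 mS.
  rewrite -eqT -eS => -> e.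
  have fS : mass mu1 D1 G1 X1 S \is a fin_num.
    rewrite ge0_fin_numE; last by apply: integral_ge0 => w _; rewrite lee_fin.
    apply: le_lt_trans finT; rewrite (massC _ _ mu1 D1 G1 X1 S) // leeDl //.
    by apply: integral_ge0 => w _; rewrite lee_fin.
  have := congr1 (fun x => x - mass mu1 D1 G1 X1 S)%E e.
  by rewrite ![(mass mu1 D1 G1 X1 S + _)%E]addeC !addeK.
- by move=> F mF tF eF; rewrite !massU //; apply: eq_eseriesr => n _.
Qed.

End mass.

Definition dotr (R : realType) (N : nat) (a s : 'rV[R]_N) : R :=
  \sum_i a ord0 i * s ord0 i.

(** The joint tails encode the marginal laws and independence at once; at [s = 0] they give
    positivity almost surely. *)
Definition exponential_vector (R : realType) (N : nat) (d : measure_display)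
    (T : measurableType d) (P : probability T R) (a : 'rV[R]_N)
    (X : T -> 'rV[R]_N) : Prop :=
  [/\ forall i, 0 < a ord0 i,
      forall i, measurable_fun setT (fun w => X w ord0 i) &
      forall s : 'rV[R]_N, (forall i, 0 <= s ord0 i) ->
        P (X @^-1` orthant s) = (expR (- dotr a s))%:E].

Section exponential_vector.
Variables (R : realType) (N : nat) (d : measure_display) (T : measurableType d)
  (P : probability T R) (a : 'rV[R]_N) (X : T -> 'rV[R]_N).
Hypothesis XP : exponential_vector P a X.

Lemma dotrD (s t : 'rV[R]_N) : dotr a (s + t) = dotr a s + dotr a t.
Proof. by rewrite -big_split; apply: eq_bigr => i _; rewrite mxE mulrDr. Qed.

Lemma dotr_sum (I : finType) (c : I -> R) (v : I -> 'rV[R]_N) :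
  dotr a (\sum_i c i *: v i) = \sum_i c i * dotr a (v i).
Proof.
rewrite /dotr; under eq_bigr do rewrite summxE mulr_sumr.
rewrite exchange_big; apply: eq_bigr => i _; rewrite mulr_sumr.
by apply: eq_bigr => l _; rewrite mxE mulrCA.
Qed.

Lemma measurable_exponential_vector : measurable_fun setT (X : T -> vecT R N).
Proof. by apply: measurable_vec; case: XP. Qed.

Lemma measurable_orthant s : measurable (orthant s : set (vecT R N)).
Proof. by apply: sub_sigma_algebra; exists s. Qed.

Lemma measurable_preimage (E : set (vecT R N)) : measurable E ->
  measurable (X @^-1` E).
Proof.
by move=> mE; rewrite -[X in measurable X]setTI; exact: measurable_exponential_vector.
Qed.

Lemma exponential_vector_gt0 : P (X @^-1` orthant 0) = 1%E.
Proof.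
case: XP => _ _ -> => [|i]; last by rewrite mxE.
by rewrite /dotr big1 ?oppr0 ?expR0 // => i _; rewrite mxE mulr0.
Qed.

(** Both sides are finite measures in [E], so orthants suffice, and there the exponential tail at a
    sum of two thresholds factors. *)
Lemma memoryless (p : 'rV[R]_N) (E : set (vecT R N)) :
  (forall i, 0 <= p ord0 i) -> measurable E ->
  P (X @^-1` orthant p `&` [set w | E (X w - p)]) =
  ((expR (- dotr a p))%:E * P (X @^-1` orthant 0 `&` X @^-1` E))%E.
Proof.
move=> p0 mE; have [a0 mX tail] := XP.
have mXT := measurable_exponential_vector.
have mY : measurable_fun setT ((fun w => X w - p) : T -> vecT R N).
  apply: measurable_vec => i; under eq_fun do rewrite !mxE.
  by apply: measurable_funD => //; exact: measurable_cst.
have mO s : measurable (X @^-1` orthant s).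
  by apply: measurable_preimage; exact: measurable_orthant.
have mI (Y : T -> vecT R N) s (S : set (vecT R N)) : measurable_fun setT Y ->
    measurable S -> measurable (X @^-1` orthant s `&` Y @^-1` S).
  by move=> ? mS; apply: measurableI => //; rewrite -[X in measurable X]setTI; auto.
have massE (Y : T -> vecT R N) (r : R) s (S : set (vecT R N)) :
    measurable_fun setT Y -> measurable S ->
    mass P (X @^-1` orthant s) (cst r) Y S =
    (r%:E * P (X @^-1` orthant s `&` Y @^-1` S))%E.
  by move=> ? ?; apply: (integral_cst P _ r%:E); exact: mI.
pose c := expR (- dotr a p); pose Y : T -> vecT R N := fun w => X w - p.
have t0 : P (X @^-1` orthant 0) = 1%E by exact: exponential_vector_gt0.
have e1 : mass P (X @^-1` orthant p) (cst 1) Y setT = c%:E.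
  by rewrite massE // preimage_setT setIT mul1e tail.
have e2 : mass P (X @^-1` orthant 0) (cst c) X setT = c%:E.
  by rewrite massE // preimage_setT setIT t0 mule1.
rewrite -[LHS]mul1e -(massE Y) // -(massE X) //.
apply: mass_unique => //.
- by move=> w; exact: expR_ge0.
- by rewrite e1 ltry.
- by rewrite e1 e2.
(* The tail formula covers nonnegative thresholds only; on the positive orthant negative ones may be
   replaced by 0. *)
move=> s; pose s0 : 'rV[R]_N := \row_i Num.max 0 (s ord0 i).
have s00 i : 0 <= s0 ord0 i by rewrite mxE le_max lexx.
rewrite !massE ?mul1e //; try exact: measurable_orthant.
have -> : X @^-1` orthant p `&` (fun w => X w - p) @^-1` orthant s =
    X @^-1` orthant (p + s0).
  apply/seteqP; split => w /=.
    case=> H1 H2 i; have := H1 i; have := H2 i; rewrite !mxE.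
    by case: (leP 0 (s ord0 i)) => ?; lra.
  move=> H; split => i; have := H i; rewrite !mxE; last first.
    by have : s ord0 i <= Num.max 0 (s ord0 i); [rewrite le_max lexx orbT|lra].
  by have : 0 <= Num.max 0 (s ord0 i); [rewrite le_max lexx|lra].
have -> : X @^-1` orthant 0 `&` X @^-1` orthant s = X @^-1` orthant s0.
  apply/seteqP; split => w /=.
    case=> H1 H2 i; have := H1 i; have := H2 i; rewrite !mxE => ? ?.
    by rewrite gt_max; apply/andP; split.
  move=> H; split => i; have := H i; rewrite !mxE gt_max => /andP[] //.
rewrite !tail // => [|i]; last by rewrite mxE addr_ge0.
by rewrite dotrD opprD expRD EFinM.
Qed.

Lemma measurable_linear (c : 'I_N -> R) :
  measurable_fun setT (fun x : vecT R N => \sum_i (x : 'rV[R]_N) ord0 i * c i).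
Proof.
apply: measurable_sum => i; apply: measurable_funM => //.
exact: measurable_coord.
Qed.

(* Infinitely many disjoint translates of the hyperplane have probability bounded
   below by a fixed multiple of its own. *)
Lemma hyperplane_null (c : 'I_N -> R) : (exists i, c i != 0) ->
  P (X @^-1` orthant 0 `&` [set w | \sum_i X w ord0 i * c i = 0]) = 0%E.
Proof.
case=> l cl0; have [a0 mX tail] := XP.
pose E : set (vecT R N) := [set x | \sum_i (x : 'rV[R]_N) ord0 i * c i = 0].
have mE : measurable E.
  have := measurable_linear c measurableT (measurable_set1 0).
  by rewrite setTI; congr measurable; apply/seteqP.
(* Shifts of length at most 1 keep the memoryless factor at least [expR (- a ord0 l)], and
   [c l != 0] puts the translates on distinct levels of the linear form. *)
pose p (j : nat) : 'rV[R]_N := j.+1%:R^-1 *: delta_mx ord0 l.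
have p0 j i : 0 <= p j ord0 i by rewrite !mxE mulr_ge0 ?invr_ge0 ?ler0n.
pose A j := X @^-1` orthant (p j) `&` [set w | E (X w - p j)].
have mA j : measurable (A j).
  apply: measurableI; first by apply: measurable_preimage; exact: measurable_orthant.
  have mY : measurable_fun setT ((fun w => X w - p j) : T -> vecT R N).
    apply: measurable_vec => i; under eq_fun do rewrite mxE [(- p j) _ _]mxE.
    by apply: measurable_funD => //; exact: measurable_cst.
  by have := mY measurableT E mE; rewrite setTI.
have AE w j : A j w -> \sum_i X w ord0 i * c i = j.+1%:R^-1 * c l.
  have pc : \sum_i p j ord0 i * c i = j.+1%:R^-1 * c l.
    rewrite (bigD1 l) //= !mxE !eqxx mulr1 big1 ?addr0 // => i /negPf il.
    by rewrite !mxE il andbF mulr0 mul0r.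
  have Xp : \sum_i (X w - p j) ord0 i * c i =
      \sum_i X w ord0 i * c i - \sum_i p j ord0 i * c i.
    by rewrite -sumrB; apply: eq_bigr => i _; rewrite -mulrBl mxE [(- p j) _ _]mxE.
  by case=> _ /= Ew; apply/eqP; rewrite -pc -subr_eq0 -Xp; apply/eqP.
have tA : trivIset setT A.
  apply/trivIsetP => i j _ _ ij; rewrite -subset0 => w [/AE Ai /AE].
  rewrite Ai => /(mulIf cl0)/invr_inj/eqP; rewrite eqr_nat eqSS.
  by rewrite (negPf ij).
set P0 := P _; have P0f : P0 \is a fin_num.
  apply: fin_num_measure; apply: measurableI; last exact: (measurable_preimage mE).
  exact: (measurable_preimage (measurable_orthant 0)).
have P0ge : 0 <= fine P0 by apply: fine_ge0; exact: measure_ge0.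
have PA j : ((expR (- a ord0 l) * fine P0)%:E <= P (A j))%E.
  rewrite (memoryless (p0 j) mE) EFinM fineK //.
  apply: lee_wpmul2r; first exact: measure_ge0.
  rewrite lee_fin ler_expR lerN2 /dotr (bigD1 l) //= !mxE !eqxx mulr1.
  rewrite big1 ?addr0 => [|i /negPf il]; last by rewrite !mxE il andbF !mulr0.
  by apply: ler_piMr; [exact: ltW|rewrite invf_le1 ?ltr0n // ler1n].
have bound M : M%:R * (expR (- a ord0 l) * fine P0) <= 1.
  rewrite mulr_natl -[X in _ *+ X]card_ord -sumr_const -lee_fin -sumEFin.
  apply: (@le_trans _ _ (P (\big[setU/set0]_(j < M) A j))).
    by rewrite measure_bigsetU //; apply: lee_sum => j _; exact: PA.
  by apply: probability_le1; exact: bigsetU_measurable.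
apply/eqP; rewrite -(fineK P0f) eqe; apply/eqP/le_anti; rewrite P0ge andbT.
rewrite leNgt; apply/negP => P0gt.
have e0 : 0 < expR (- a ord0 l) * fine P0 by rewrite mulr_gt0 ?expR_gt0.
have := bound (Num.bound (expR (- a ord0 l) * fine P0)^-1).
rewrite leNgt => /negP; apply; rewrite -ltr_pdivrMr // div1r.
by apply: archi_boundP; rewrite invr_ge0 ltW.
Qed.
End exponential_vector.

(** * One-dimensional exponential integrals and exponential tilting *)

Section exponential_integrals.
Variable R : realType.
Notation mu := (@lebesgue_measure R).

Lemma measurable_exponential_pdfE (r : R) (D : set R) :
  measurable_fun D (fun x => (exponential_pdf r x)%:E).
Proof.
apply/measurable_EFinP; apply: measurable_funTS.
exact: measurable_exponential_pdf.
Qed.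

Lemma exponential_prob_itvcy (r s : R) : 0 < r -> 0 <= s ->
  exponential_prob r `[s, +oo[ = (expR (- r * s))%:E.
Proof.
move=> r0 s0; have cexp : continuous (fun z : R^o => expR (- r * z)).
  move=> z; apply: continuous_comp; last exact: continuous_expR.
  by apply: continuousM => //; apply: (@continuousN _ R^o); exact: cst_continuous.
rewrite /exponential_prob (@ge0_continuous_FTC2y _ _
  (fun x => - (expR (- r * x))) _ 0).
- by rewrite EFinN oppeK add0e.
- by move=> x _; apply: exponential_pdf_ge0; exact: ltW.
- apply: (@continuous_subspaceW R^o _ _ [set` `[0, +oo[%R]).
    by move=> x /=; rewrite !in_itv /= !andbT; exact: le_trans.
  exact: within_continuous_exponential_pdf.
- rewrite -oppr0; apply: cvgN.
  rewrite (_ : (fun x => expR (- r * x)) =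
               (fun z => expR (- z)) \o (fun z => r * z)); last first.
    by apply: eq_fun => x; rewrite mulNr.
  apply: (@cvg_comp _ _ _ _ _ _ (pinfty_nbhs R)); last exact: cvgr_expR.
  exact: gt0_cvgMry.
- by move=> x _; exact: ex_derive.
- by apply: cvgN; apply/cvg_at_right_filter; exact: cexp.
- move=> x; rewrite in_itv /= andbT => sx; apply: derive1_exponential_pdf.
  by rewrite in_itv /= andbT (le_lt_trans s0).
Qed.

Lemma exponential_prob_itvoy (r s : R) : 0 < r -> 0 <= s ->
  exponential_prob r `]s, +oo[ = (expR (- r * s))%:E.
Proof.
move=> r0 s0; rewrite -exponential_prob_itvcy // /exponential_prob.
by apply: integral_itv_obnd_cbnd; exact: measurable_exponential_pdfE.
Qed.

Lemma exponential_prob_itvoo (r s t : R) : 0 < r -> 0 <= s -> s < t ->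
  exponential_prob r `]s, t[ = (expR (- r * s) - expR (- r * t))%:E.
Proof.
move=> r0 s0 st.
have := exponential_prob_itvoy r0 s0.
have t0 : 0 <= t by rewrite (le_trans s0) // ltW.
have -> : `]s, +oo[%classic = `]s, t[%classic `|` `[t, +oo[%classic :> set R.
  apply/seteqP; split => x /=; rewrite !in_itv /= !andbT.
    by move=> sx; case: (ltP x t) => xt; [left|right]; rewrite ?sx.
  by case=> [/andP[]|] //; exact: lt_le_trans.
rewrite /exponential_prob ge0_integral_setU //.
- rewrite -/(exponential_prob r `[t, +oo[) exponential_prob_itvcy //.
  by move=> e; rewrite EFinB -e addeK.
- exact: measurable_exponential_pdfE.
- by move=> x _; rewrite lee_fin exponential_pdf_ge0 // ltW.
- by apply/disj_setPS => x /= []; rewrite !in_itv /= andbT => /andP[_]; rewrite ltNge => /negP.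
Qed.

Lemma integral_expR_exponential_pdf (r c s : R) : 0 < r -> 0 <= c -> 0 <= s ->
  (\int[mu]_(x in `]s, +oo[) (expR (- c * x) * exponential_pdf r x)%:E)%E =
  (r / (r + c) * expR (- (r + c) * s))%:E.
Proof.
move=> r0 c0 s0; have rc0 : 0 < r + c by rewrite ltr_pwDl.
transitivity (\int[mu]_(x in `]s, +oo[)
   ((r / (r + c))%:E * (exponential_pdf (r + c) x)%:E))%E.
  apply: eq_integral => x; rewrite inE /= in_itv /= andbT => sx.
  have x0 : 0 <= x by rewrite (le_trans s0) // ltW.
  rewrite -EFinM !exponential_pdfE //; congr EFin.
  rewrite [RHS]mulrA divfK ?gt_eqF // mulrCA -expRD; congr (_ * expR _); ring.
rewrite ge0_integralZl //.
- by rewrite -/(exponential_prob (r + c) _) exponential_prob_itvoy // EFinM.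
- exact: measurable_exponential_pdfE.
- by move=> x _; rewrite lee_fin exponential_pdf_ge0 // ltW.
- by rewrite lee_fin divr_ge0 // ltW.
Qed.

Lemma integral_scaled_exponential_pdf (r K : R) : 0 < r -> 0 <= K ->
  (\int[mu]_(x in `[0%R, +oo[) (K%:E * (exponential_pdf r x)%:E))%E = K%:E.
Proof.
move=> r0 K0; rewrite ge0_integralZl //.
- by rewrite -/(exponential_prob r _) exponential_prob_itvcy // mulr0 expR0 mule1.
- exact: measurable_exponential_pdfE.
- by move=> x _; rewrite lee_fin exponential_pdf_ge0 // ltW.
Qed.

End exponential_integrals.

Section tilting.
Variables (R : realType) (d : measure_display) (T : measurableType d)
  (P : probability T R).
Notation mu := (@lebesgue_measure R).

Lemma measurable_gt (Y : T -> R) (s : R) : measurable_fun setT Y ->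
  measurable [set w | s < Y w].
Proof.
move=> mY; have -> : [set w | s < Y w] = Y @^-1` `]s, +oo[%classic.
  by apply/seteqP; split => w /=; rewrite in_itv /= andbT.
by rewrite -[X in measurable X]setTI; exact: mY.
Qed.

(* Fubini applied to [expR (- c * s0) - expR (- c * y)], the probability of
   ]s0, y[ under the exponential law of rate [c]. *)
Lemma tilt_coordinate (F : set T) (G Y : T -> R) (C b c s0 : R) :
  measurable F -> measurable_fun setT G -> measurable_fun setT Y ->
  (forall w, 0 <= G w) -> 0 < b -> 0 < c -> 0 <= s0 ->
  (forall r, s0 <= r -> (\int[P]_(w in F `&` [set w | (r < Y w)%R]) (G w)%:E =
    (C * expR (- b * r))%:E)%E) ->
  (\int[P]_(w in F `&` [set w | (s0 < Y w)%R]) (G w * expR (- c * Y w))%:E =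
    (C * (b / (b + c)) * expR (- (b + c) * s0))%:E)%E.
Proof.
move=> mF mG mY G0 b0 c0 s00 tail.
have bc0 : 0 < b + c by rewrite addr_gt0.
have mFr r : measurable (F `&` [set w | (r < Y w)%R]).
  by apply: measurableI => //; exact: measurable_gt.
have C0 : 0 <= C.
  have : (0 <= (C * expR (- b * s0))%:E)%E.
    by rewrite -tail //; apply: integral_ge0 => w _; rewrite lee_fin.
  by rewrite lee_fin pmulr_lge0 // expR_gt0.
pose A : set (T * measurableTypeR R) :=
  [set p | [/\ F p.1, s0 < p.2 & p.2 < Y p.1]].
have mA : measurable A.
  have -> : A = (fst @^-1` F) `&` ((snd @^-1` `]s0, +oo[%classic) `&`
      [set p | (snd p < (Y \o fst) p)%R]).
    apply/seteqP; split => p /=; rewrite in_itv /= andbT.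
      by case.
    by case=> ? [].
  apply: measurableI.
    by rewrite -[X in measurable X]setTI; exact: measurable_fst.
  apply: measurableI.
    by rewrite -[X in measurable X]setTI; exact: measurable_snd.
  have : measurable_fun setT (fun p : T * measurableTypeR R => (snd p < (Y \o fst) p)%R).
    by apply: measurable_fun_ltr => //; exact: measurableT_comp.
  move=> /(_ measurableT [set true]); rewrite setTI => H; have := H I.
  by congr measurable; apply/seteqP.
(* Integrating out the real variable first gives [G] times the probability of the interval;
   integrating out [w] first brings in the assumed tails of [Y]. *)
pose h (p : T * measurableTypeR R) : \bar R :=
  (G p.1 * \1_A p * exponential_pdf c p.2)%:E.
have mh : measurable_fun setT h.
  apply/measurable_EFinP; apply: measurable_funM.
    apply: measurable_funM; last exact: measurable_indic.
    exact: measurableT_comp.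
  by apply: measurableT_comp => //; exact: measurable_exponential_pdf.
have h0 p : (0 <= h p)%E.
  by rewrite lee_fin !mulr_ge0 // exponential_pdf_ge0 // ltW.
have := @fubini_tonelli _ _ T (measurableTypeR R) R P mu h mh h0.
have -> : (\int[P]_w \int[mu]_r h (w, r) =
    \int[P]_(w in F `&` [set w | (s0 < Y w)%R])
       (G w * (expR (- c * s0) - expR (- c * Y w)))%:E)%E.
  rewrite [RHS]integral_mkcond; apply: eq_integral => w _.
  rewrite patchE; case: ifPn => [|wF].
    rewrite inE => -[/= Fw sY].
    rewrite EFinM -(exponential_prob_itvoo c0 s00 sY) /exponential_prob.
    rewrite -ge0_integralZl //; last 3 first.
    - exact: measurable_exponential_pdfE.
    - by move=> r _; rewrite lee_fin exponential_pdf_ge0 // ltW.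
    - by rewrite lee_fin.
    rewrite [RHS]integral_mkcond; apply: eq_integral => r _.
    rewrite patchE /h /= indicE; case: ifPn => [|rs].
      rewrite inE /= in_itv /= => /andP[sr rY].
      by rewrite mem_set //= mulr1 -EFinM.
    rewrite memNset ?mulr0 ?mul0r // => -[_ /= sr rY].
    by move: rs; rewrite notin_setE /= in_itv /= sr rY.
  apply: integral0_eq => r _; rewrite /h /= indicE memNset ?mulr0 ?mul0r //.
  move=> [/= Fw sr rY]; move: wF; rewrite notin_setE; apply; split => //=.
  exact: lt_trans rY.
have -> : (\int[mu]_r \int[P]_w h (w, r) =
    \int[mu]_(r in `]s0, +oo[) (C%:E * (expR (- b * r) * exponential_pdf c r)%:E))%E.
  rewrite [RHS]integral_mkcond; apply: eq_integral => r _.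
  rewrite patchE; case: ifPn => [|rs].
    rewrite inE /= in_itv /= andbT => sr.
    rewrite -EFinM mulrA EFinM -(tail _ (ltW sr)) muleC -ge0_integralZl //; last 3 first.
    - exact/measurable_EFinP/measurable_funTS.
    - by move=> w _; rewrite lee_fin.
    - by rewrite lee_fin exponential_pdf_ge0 // ltW.
    rewrite [RHS]integral_mkcond; apply: eq_integral => w _.
    rewrite patchE /h /= indicE; case: ifPn => [|wF].
      rewrite inE /= => -[Fw rY].
      by rewrite mem_set //= mulr1 -EFinM mulrC.
    rewrite memNset ?mulr0 ?mul0r // => -[/= Fw _ rY].
    by move: wF; rewrite notin_setE; apply.
  apply: integral0_eq => w _; rewrite /h /= indicE memNset ?mulr0 ?mul0r //.
  by move=> [/= _ sr _]; move: rs; rewrite notin_setE /= in_itv /= sr.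
have mexp (D : set T) : measurable_fun D (fun w => expR (- c * Y w)).
  apply: measurable_funTS; apply: measurableT_comp => //.
  by apply: measurable_funM => //; exact: measurable_cst.
rewrite ge0_integralZl //; last 2 first.
- apply/measurable_EFinP; apply: measurable_funTS; apply: measurable_funM.
    by apply: measurableT_comp => //; exact: measurable_funM.
  exact: measurable_exponential_pdf.
- move=> r _; rewrite lee_fin mulr_ge0 ?expR_ge0 //.
  by rewrite exponential_pdf_ge0 // ltW.
rewrite integral_expR_exponential_pdf //; last exact: ltW.
move=> diff; have sum : (\int[P]_(w in F `&` [set w | (s0 < Y w)%R])
      (G w * (expR (- c * s0) - expR (- c * Y w)))%:E +
    \int[P]_(w in F `&` [set w | (s0 < Y w)%R]) (G w * expR (- c * Y w))%:E)%E =
    (expR (- c * s0) * (C * expR (- b * s0)))%:E.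
  rewrite EFinM -tail // -ge0_integralZl ?lee_fin ?expR_ge0 //; last 2 first.
  - exact/measurable_EFinP/measurable_funTS.
  - by move=> w _; rewrite lee_fin.
  rewrite -ge0_integralD //.
  - by apply: eq_integral => w _; rewrite -EFinD -EFinM -mulrDr subrK mulrC.
  - move=> w [_ /= sY]; rewrite lee_fin mulr_ge0 // subr_ge0 ler_expR.
    by rewrite !mulNr lerN2 ler_pM2l // ltW.
  - apply/measurable_EFinP; apply: measurable_funM; first exact: measurable_funTS.
    by apply: measurable_funB; [exact: measurable_cst|exact: mexp].
  - by move=> w _; rewrite lee_fin mulr_ge0 // expR_ge0.
  - apply/measurable_EFinP; apply: measurable_funM; first exact: measurable_funTS.
    exact: mexp.
move: sum; rewrite diff => sum.
rewrite -[LHS](addeK _ (_ : (C%:E * (c / (c + b) * expR (- (c + b) * s0))%:E)%E \is a fin_num)) //.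
rewrite [X in (X - _)%E]addeC sum -EFinM -EFinB; congr EFin.
rewrite mulrCA -expRD -mulrA -mulrBr -mulrA; congr (_ * _).
rewrite [c + b]addrC; have -> : - c * s0 + - b * s0 = - (b + c) * s0 by ring.
by field; rewrite gt_eqF.
Qed.
End tilting.

Section exponential_tails.
Variables (R : realType) (N : nat) (d : measure_display) (T : measurableType d)
  (P : probability T R).

(** Unnormalised joint tails: [K] is the mass of the positive orthant, which for cone coordinates is
    the probability of the cone. *)
Definition exponential_tails (b : 'rV[R]_N) (K : R) (Y : T -> 'rV[R]_N) : Prop :=
  forall s : 'rV[R]_N, (forall i, 0 <= s ord0 i) ->
    P (Y @^-1` orthant s) = (K * expR (- dotr b s))%:E.

Lemma measurable_dotr (c : 'rV[R]_N) (Y : T -> 'rV[R]_N) :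
  (forall i, measurable_fun setT (fun w => Y w ord0 i)) ->
  measurable_fun setT (fun w => dotr c (Y w)).
Proof.
by move=> mY; apply: measurable_sum => i; apply: measurable_funM.
Qed.

(** The density acts coordinatewise, raising the rate [b_i] to [b_i + c_i] at the price of the
    factor [b_i / (b_i + c_i)]. The coordinates are tilted one after the other, [cn n] being [c] cut
    off after n of them. *)
Lemma tilt (b c : 'rV[R]_N) (K : R) (Y : T -> 'rV[R]_N) :
  (forall i, measurable_fun setT (fun w => Y w ord0 i)) ->
  (forall i, 0 < b ord0 i) -> (forall i, 0 <= c ord0 i) ->
  exponential_tails b K Y ->
  forall s : 'rV[R]_N, (forall i, 0 <= s ord0 i) ->
  (\int[P]_(w in Y @^-1` orthant s) (expR (- dotr c (Y w)))%:E =
   (K * (\prod_i (b ord0 i / (b ord0 i + c ord0 i))) * expR (- dotr (b + c) s))%:E)%E.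
Proof.
move=> mY b0 c0 tail.
have mO s : measurable (Y @^-1` orthant s).
  rewrite -[X in measurable X]setTI; apply: (measurable_vec mY) => //.
  exact: measurable_orthant.
pose cn (n : nat) : 'rV[R]_N := \row_i if (i < n)%N then c ord0 i else 0.
have cnN : cn N = c by apply/rowP => i; rewrite mxE ltn_ord.
suff main n : (n <= N)%N -> forall s : 'rV[R]_N, (forall i, 0 <= s ord0 i) ->
    (\int[P]_(w in Y @^-1` orthant s) (expR (- dotr (cn n) (Y w)))%:E =
     (K * (\prod_i (b ord0 i / (b ord0 i + cn n ord0 i))) *
       expR (- dotr (b + cn n) s))%:E)%E.
  by move: (main N (leqnn N)); rewrite cnN.
elim: n => [_|n IH nN] s s0.
  transitivity (P (Y @^-1` orthant s)).
    rewrite -[RHS]mul1e -(integral_cst P (mO s)); apply: eq_integral => w _.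
    by rewrite /dotr big1 ?oppr0 ?expR0 // => i _; rewrite mxE mul0r.
  rewrite tail //; congr EFin.
  rewrite big1 ?mulr1 => [|i _]; last by rewrite mxE addr0 divff // gt_eqF.
  by congr (_ * expR (- _)); apply: eq_bigr => i _; rewrite !mxE addr0.
pose i0 : 'I_N := Ordinal nN; have {}IH := IH (ltnW nN).
have cnE i : i != i0 -> cn n.+1 ord0 i = cn n ord0 i.
  by move=> ii0; rewrite !mxE ltnS leq_eqVlt -[_ == n]/(i == i0) (negPf ii0).
have cni0 : cn n ord0 i0 = 0 by rewrite mxE ltnn.
have cni1 : cn n.+1 ord0 i0 = c ord0 i0 by rewrite mxE ltnSn.
(* A zero rate defines no exponential law for the Fubini argument, but it leaves the density
   unchanged. *)
have [ce|cn0] := eqVneq (c ord0 i0) 0.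
  have -> : cn n.+1 = cn n; last exact: IH.
  by apply/rowP => i; have [->|/cnE //] := eqVneq i i0; rewrite cni0 cni1.
have {cn0}c_gt0 : 0 < c ord0 i0 by rewrite lt_def cn0 c0.
pose F := [set w | forall j, j != i0 -> s ord0 j < Y w ord0 j].
have mF : measurable F.
  apply: measurable_forall => j; case: (j != i0).
    rewrite (_ : [set w | _] = [set w | s ord0 j < Y w ord0 j]); first exact: measurable_gt.
    by apply/seteqP; split => w /=; [apply|].
  by rewrite (_ : [set w | _] = setT) //; apply/seteqP; split.
pose G w := expR (- dotr (cn n) (Y w)).
have mG : measurable_fun setT G.
  apply: measurableT_comp => //; apply: measurable_funN => //.
  exact: measurable_dotr.
pose sr r : 'rV[R]_N := \row_j if j == i0 then r else s ord0 j.
have srE r : F `&` [set w | r < Y w ord0 i0] = Y @^-1` orthant (sr r).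
  apply/seteqP; split => w /=.
    by case=> Fw rY j; rewrite mxE; case: eqVneq => [->//|]; exact: Fw.
  move=> H; split; last by have := H i0; rewrite mxE eqxx.
  by move=> j ji0; have := H j; rewrite mxE (negPf ji0).
have dsplit (u v : 'rV[R]_N) : dotr u v =
    u ord0 i0 * v ord0 i0 + \sum_(j | j != i0) u ord0 j * v ord0 j.
  by rewrite /dotr (bigD1 i0).
pose rest := \sum_(j | j != i0) (b + cn n) ord0 j * s ord0 j.
pose C := K * (\prod_i (b ord0 i / (b ord0 i + cn n ord0 i))) * expR (- rest).
have tailG r : s ord0 i0 <= r ->
    (\int[P]_(w in F `&` [set w | (r < Y w ord0 i0)%R]) (G w)%:E =
    (C * expR (- b ord0 i0 * r))%:E)%E.
  move=> sir; rewrite srE IH; last first.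
    by move=> j; rewrite mxE; case: ifP => // _; exact: le_trans sir.
  rewrite /C -!mulrA -expRD dsplit !mxE ltnn addr0 eqxx; congr (_ * (_ * expR _))%:E.
  rewrite opprD addrC mulNr; congr (- _ - _); apply: eq_bigr => j ji0.
  by rewrite [sr r _ _]mxE (negPf ji0).
have := tilt_coordinate mF mG (mY i0) (fun w => expR_ge0 _) (b0 i0) c_gt0 (s0 i0) tailG.
rewrite srE.
have -> : sr (s ord0 i0) = s.
  by apply/rowP => j; rewrite mxE; case: eqVneq => // ->.
have -> : (fun w => (G w * expR (- c ord0 i0 * Y w ord0 i0))%:E) =
    (fun w => (expR (- dotr (cn n.+1) (Y w)))%:E).
  apply/funext => w; rewrite /G -expRD !dsplit cni0 cni1 mul0r add0r.
  congr (expR _)%:E; rewrite opprD addrC mulNr; congr (_ - _).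
  by apply: eq_bigr => j ji0; rewrite cnE.
move=> ->; congr EFin; rewrite /C.
rewrite [in RHS](bigD1 i0) //= [in LHS](bigD1 i0) //= cni0 cni1 addr0.
rewrite divff ?gt_eqF // mul1r dsplit [(b + cn n.+1) ord0 i0]mxE cni1.
have -> : \sum_(j | j != i0) (b + cn n.+1) ord0 j * s ord0 j = rest.
  by apply: eq_bigr => j ji0; rewrite mxE cnE // [in RHS]mxE.
have -> : \prod_(i | i != i0) (b ord0 i / (b ord0 i + cn n.+1 ord0 i)) =
    \prod_(i | i != i0) (b ord0 i / (b ord0 i + cn n ord0 i)).
  by apply: eq_bigr => j ji0; rewrite cnE.
have -> : - ((b ord0 i0 + c ord0 i0) * s ord0 i0 + rest) =
    - rest + - (b ord0 i0 + c ord0 i0) * s ord0 i0 by ring.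
rewrite expRD; ring.
Qed.

End exponential_tails.

(** * Probability of a simplicial cone *)

Section cone_probability.
Variables (R : realType) (N : nat) (J : finType) (V : J -> 'rV[R]_N).
Hypothesis V_ge0 : forall a l, 0 <= V a ord0 l.
Variable g : {ffun 'I_N -> J}.
Hypothesis gu : gens V g \in unitmx.

Definition open_cone : set 'rV[R]_N := [set x | in_cone V g x].
Definition cone_rates (a : 'rV[R]_N) : 'rV[R]_N := \row_i dotr a (V (g i)).

Lemma open_coneE x : open_cone x <-> orthant 0 (coords V g x).
Proof.
by split => [/forallP H i|H]; [rewrite mxE|apply/forallP => i; have := H i; rewrite mxE].
Qed.

Lemma gens_pos_entry l : exists i, 0 < V (g i) ord0 l.
Proof.
apply/existsP; apply: contraT; rewrite negb_exists => /forallP V0.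
have Vl i : V (g i) ord0 l = 0.
  by apply/eqP; rewrite eq_le V_ge0 leNgt V0.
have := coordsK (delta_mx ord0 l) gu; rewrite gens_sum => /rowP/(_ l).
rewrite summxE big1 => [|i _]; last by rewrite mxE Vl mulr0.
by rewrite mxE !eqxx => /eqP; rewrite eq_sym oner_eq0.
Qed.

(** An invertible [gens] has no zero column, so every coordinate is positive in some generator and
    nonnegative in all. *)
Lemma open_cone_gt0 : open_cone `<=` orthant 0.
Proof.
move=> x /forallP x0 l; rewrite -[x in X in _ < X](coordsK x gu) gens_sum summxE mxE.
have [i Vi] := gens_pos_entry l; rewrite (bigD1 i) //= ltr_pwDl //.
  by rewrite mxE mulr_gt0.
by apply: sumr_ge0 => j _; rewrite mxE mulr_ge0 // ltW.
Qed.

Lemma measurable_coords i :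
  measurable_fun setT (fun x : vecT R N => coords V g x ord0 i).
Proof.
under eq_fun do rewrite mxE.
exact: measurable_linear.
Qed.

Lemma measurable_open_cone : measurable (open_cone : set (vecT R N)).
Proof.
have -> : open_cone = [set x | forall i, 0 < coords V g x ord0 i].
  by apply/seteqP; split => x /forallP.
by apply: measurable_forall => i; apply: measurable_gt; exact: measurable_coords.
Qed.

Lemma cone_rates_gt0 (a : 'rV[R]_N) : (forall i, 0 < a ord0 i) -> forall i, 0 < cone_rates a ord0 i.
Proof.
move=> a0 i; rewrite mxE /dotr lt_def sumr_ge0 ?andbT; last first.
  by move=> l _; rewrite mulr_ge0 // ltW.
rewrite psumr_eq0; last by move=> l _; rewrite mulr_ge0 // ltW.
apply/negP => /allP H; have := coords_gen i gu.
suff -> : V (g i) = 0.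
  rewrite /coords mul0mx => /rowP/(_ i); rewrite !mxE !eqxx => /eqP.
  by rewrite eq_sym oner_eq0.
apply/rowP => l; have := H l; rewrite mem_index_enum mulf_eq0 gt_eqF //= mxE.
by move=> /(_ isT) /eqP.
Qed.

Lemma dotr_coords c x : dotr c x = dotr (cone_rates c) (coords V g x).
Proof.
rewrite -{1}(coordsK x gu) gens_sum dotr_sum; apply: eq_bigr => i _.
by rewrite [in RHS]mxE mulrC.
Qed.

Section one_vector.
Variables (d : measure_display) (T : measurableType d) (P : probability T R)
  (a : 'rV[R]_N) (X : T -> 'rV[R]_N).
Hypothesis XP : exponential_vector P a X.

Definition cone_prob : R := fine (P (X @^-1` open_cone)).

Lemma measurable_cone_coords i :
  measurable_fun setT (fun w => coords V g (X w) ord0 i).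
Proof.
apply: (@measurableT_comp _ _ _ _ _ _ (fun x : vecT R N => coords V g x ord0 i)).
  exact: measurable_coords.
exact: (measurable_exponential_vector XP).
Qed.

Lemma measurable_preimage_cone : measurable (X @^-1` open_cone).
Proof. exact: (measurable_preimage XP measurable_open_cone). Qed.

Lemma cone_probE : P (X @^-1` open_cone) = cone_prob%:E.
Proof. by rewrite fineK //; exact: fin_num_measure measurable_preimage_cone. Qed.

(** Raising the thresholds of the cone coordinates to [s] is translating the cone by
    [p = s *m gens V g], a nonnegative vector, so memorylessness applies at [p]. *)
Lemma cone_tails :
  exponential_tails P (cone_rates a) cone_prob (fun w => coords V g (X w)).
Proof.
move=> s s0; pose p := s *m gens V g.
have p0 i : 0 <= p ord0 i.
  by rewrite /p gens_sum summxE; apply: sumr_ge0 => j _; rewrite mxE mulr_ge0.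
have coordsB x : coords V g (x - p) = coords V g x - s.
  by rewrite /coords mulmxBl mulmxK.
have := memoryless XP p0 measurable_open_cone.
have -> : X @^-1` orthant p `&` [set w | open_cone (X w - p)] =
    (fun w => coords V g (X w)) @^-1` orthant s.
  apply/seteqP; split => w /=.
    case=> _ /open_coneE H i; have := H i; rewrite coordsB !mxE; lra.
  move=> H; have H' : open_cone (X w - p).
    by apply/open_coneE => i; have := H i; rewrite coordsB !mxE; lra.
  by split => // i; have := open_cone_gt0 H' i; rewrite !mxE; lra.
have -> : X @^-1` orthant 0 `&` X @^-1` open_cone = X @^-1` open_cone.
  by apply/setIidr => w; exact: open_cone_gt0.
move=> ->; rewrite cone_probE -EFinM mulrC; congr (_ * expR (- _))%:E.
by rewrite dotr_coords /coords /p mulmxK.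
Qed.

End one_vector.

Lemma exponential_vectorZ d (T : measurableType d) (P : probability T R)
    (a : 'rV[R]_N) (X : T -> 'rV[R]_N) (M : R) : 0 < M ->
  exponential_vector P a X ->
  exponential_vector P (M^-1 *: a) (fun w => M *: X w).
Proof.
move=> M0 [a0 mX tail]; split.
- by move=> i; rewrite mxE mulr_gt0 // invr_gt0.
- by move=> i; under eq_fun do rewrite mxE; exact: measurable_funM.
move=> s s0; have -> : (fun w => M *: X w) @^-1` orthant s =
    X @^-1` orthant (M^-1 *: s).
  by apply/seteqP; split => w /= H i; have := H i; rewrite !mxE ltr_pdivrMl.
rewrite tail => [|i]; last by rewrite mxE mulr_ge0 // invr_ge0 ltW.
congr (expR (- _))%:E; apply: eq_bigr => i _; rewrite !mxE; ring.
Qed.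

Definition cone_ratio (a : 'rV[R]_N) : R :=
  (\prod_i cone_rates a ord0 i) / \prod_i a ord0 i.

Lemma cone_ratio_gt0 (a : 'rV[R]_N) : (forall i, 0 < a ord0 i) -> 0 < cone_ratio a.
Proof.
by move=> a0; rewrite divr_gt0 // prodr_gt0 // => i _; exact: cone_rates_gt0.
Qed.

Lemma cone_ratioZ (M : R) (a : 'rV[R]_N) : M != 0 -> cone_ratio (M *: a) = cone_ratio a.
Proof.
move=> M0; rewrite /cone_ratio.
have -> : \prod_i cone_rates (M *: a) ord0 i = M ^+ N * \prod_i cone_rates a ord0 i.
  rewrite -[in X in _ ^+ X](card_ord N) -prodr_const -big_split /=.
  apply: eq_bigr => i _; rewrite !mxE /dotr mulr_sumr; apply: eq_bigr => l _.
  by rewrite mxE mulrA.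
have -> : \prod_i (M *: a) ord0 i = M ^+ N * \prod_i a ord0 i.
  rewrite -[in X in _ ^+ X](card_ord N) -prodr_const -big_split.
  by apply: eq_bigr => i _; rewrite !mxE.
by rewrite -mulf_div divff ?mul1r // expf_neq0.
Qed.

(** The density [G] turns the law of [X'] into that of [X]. On the cone its exponent is linear in
    the cone coordinates, which have exponential tails under [P'], so its integral there is again
    given by [tilt]. The order of the rates makes [c = a - a'] nonnegative. *)
Lemma cone_prob_tilt d d' (T : measurableType d) (T' : measurableType d')
    (P : probability T R) (P' : probability T' R) (a a' : 'rV[R]_N) X X' :
  exponential_vector P a X -> exponential_vector P' a' X' ->
  (forall i, a' ord0 i <= a ord0 i) ->
  cone_prob P X * cone_ratio a = cone_prob P' X' * cone_ratio a'.
Proof.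
move=> XP XP' a'a; have [a0 mX tail] := XP; have [a'0 mX' tail'] := XP'.
pose c := a - a'; have c0 i : 0 <= c ord0 i by rewrite !mxE subr_ge0.
have aE : a' + c = a by rewrite addrC subrK.
pose q := \prod_i a ord0 i / \prod_i a' ord0 i.
have q0 : 0 < q by rewrite divr_gt0 // prodr_gt0.
pose G w := q * expR (- dotr c (X' w)).
have mG : measurable_fun setT G.
  apply: measurable_funM => //; apply: measurableT_comp => //.
  by apply: measurable_funN; exact: measurable_dotr.
have mO d1 (T1 : measurableType d1) (P1 : probability T1 R) b (Z : T1 -> 'rV[R]_N) s :
    exponential_vector P1 b Z -> measurable (Z @^-1` orthant s).
  by move=> ZP; apply: (measurable_preimage ZP); exact: measurable_orthant.
have intG (D : set T') : measurable D -> (\int[P']_(w in D) (G w)%:E =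
    q%:E * \int[P']_(w in D) (expR (- dotr c (X' w)))%:E)%E.
  move=> mD; rewrite -ge0_integralZl ?lee_fin ?(ltW q0) //.
  apply/measurable_EFinP; apply: measurable_funTS; apply: measurableT_comp => //.
  by apply: measurable_funN; exact: measurable_dotr.
have tilt' (s : 'rV[R]_N) : (forall i, 0 <= s ord0 i) ->
    (\int[P']_(w in X' @^-1` orthant s) (G w)%:E = (expR (- dotr a s))%:E)%E.
  move=> s0; rewrite intG; last exact: mO XP'.
  rewrite (@tilt _ _ _ _ P' a' c 1) //; last by move=> u u0; rewrite mul1r tail'.
  rewrite aE -EFinM mul1r mulrA (_ : q * _ = 1) ?mul1r //.
  rewrite (eq_bigr (fun i => a' ord0 i / a ord0 i)) => [|i _]; last first.
    by rewrite -[in RHS]aE [(a' + c) _ _]mxE.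
  rewrite /q prodf_div mulf_div [X in X / _]mulrC divff //.
  by rewrite gt_eqF // mulr_gt0 // prodr_gt0.
have massP s : mass P (X @^-1` orthant 0) (cst 1) X (orthant s) =
    mass P' (X' @^-1` orthant 0) G X' (orthant s).
  pose s0 : 'rV[R]_N := \row_i Num.max 0 (s ord0 i).
  have s00 i : 0 <= s0 ord0 i by rewrite mxE le_max lexx.
  have E T1 (Z : T1 -> 'rV[R]_N) :
      Z @^-1` orthant 0 `&` Z @^-1` orthant s = Z @^-1` orthant s0.
    apply/seteqP; split => w /=.
      by case=> H1 H2 i; have := H1 i; have := H2 i; rewrite !mxE gt_max => -> ->.
    by move=> H; split => i; have := H i; rewrite !mxE gt_max => /andP[].
  rewrite /mass !E tilt' // -tail // -[RHS]mul1e.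
  by rewrite -(integral_cst P (mO _ _ _ _ _ s0 XP)).
have := @mass_unique R N _ _ T T' P P' (X @^-1` orthant 0) (X' @^-1` orthant 0)
  (cst 1) G X X'.
have setTE d1 (T1 : measurableType d1) (P1 : probability T1 R) H (Z : T1 -> 'rV[R]_N) :
    mass P1 (Z @^-1` orthant 0) H Z setT =
    mass P1 (Z @^-1` orthant 0) H Z (orthant 0).
  by rewrite /mass preimage_setT setIT setIid.
move=> /(_ (mO _ _ _ _ _ 0 XP) (mO _ _ _ _ _ 0 XP') (measurable_cst _) mG).
have G0 w : 0 <= G w by rewrite mulr_ge0 ?expR_ge0 // ltW.
move=> /(_ (fun=> ler01) G0 (measurable_exponential_vector XP)
  (measurable_exponential_vector XP')).
rewrite !setTE massP /mass setIid tilt' => [|i]; last by rewrite mxE.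
move=> /(_ (ltry _) erefl massP _ measurable_open_cone).
have IE T1 (Z : T1 -> 'rV[R]_N) :
    Z @^-1` orthant 0 `&` Z @^-1` open_cone = Z @^-1` open_cone.
  by apply/setIidr => w; exact: open_cone_gt0.
rewrite !IE intG; last exact: (measurable_preimage_cone XP').
have <- : P (X @^-1` open_cone) = (\int[P]_(w in X @^-1` open_cone) (cst 1 w)%:E)%E.
  by rewrite -[LHS]mul1e -(integral_cst P (measurable_preimage_cone XP)).
rewrite (cone_probE XP).
have -> : X' @^-1` open_cone = (fun w => coords V g (X' w)) @^-1` orthant 0.
  by apply/seteqP; split => w /open_coneE.
under eq_integral do rewrite dotr_coords.
rewrite (@tilt _ _ _ _ P' (cone_rates a') (cone_rates c) (cone_prob P' X')) //.
- have dot0 (u : 'rV[R]_N) : dotr u 0 = 0.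
    by rewrite /dotr big1 // => i _; rewrite mxE mulr0.
  have bE i : cone_rates a' ord0 i + cone_rates c ord0 i = cone_rates a ord0 i.
    rewrite !mxE -big_split /=; apply: eq_bigr => l _.
    by rewrite -mulrDl -[in RHS]aE [(a' + c) _ _]mxE.
  under eq_bigr do rewrite bE.
  rewrite dot0 oppr0 expR0 mulr1 prodf_div -EFinM => -[->].
  rewrite /cone_ratio /q; field.
  by rewrite !gt_eqF ?prodr_gt0 // => i _; exact: cone_rates_gt0.
- exact: (measurable_cone_coords XP').
- exact: cone_rates_gt0.
- by move=> i; rewrite mxE; apply: sumr_ge0 => l _; rewrite mulr_ge0.
- exact: cone_tails.
- by move=> i; rewrite mxE.
Qed.

(** Rescaling [X'] brings its rates below those of [X]; neither the event of lying in the cone nor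
    the ratio, which is homogeneous of degree 0, notices. *)
Lemma cone_prob_ratio_const d d' (T : measurableType d) (T' : measurableType d')
    (P : probability T R) (P' : probability T' R) (a a' : 'rV[R]_N) X X' :
  exponential_vector P a X -> exponential_vector P' a' X' ->
  cone_prob P X * cone_ratio a = cone_prob P' X' * cone_ratio a'.
Proof.
move=> XP XP'; have [a0 _ _] := XP; have [a'0 _ _] := XP'.
have [e e0 ea] := @small_scalar _ _ (fun i => a' ord0 i) (fun i => a ord0 i)
  (fun i => ltW (a'0 i)) a0.
have e'0 : 0 < e^-1 by rewrite invr_gt0.
have := cone_prob_tilt XP (exponential_vectorZ e'0 XP').
rewrite cone_ratioZ ?invr_eq0 ?invr_neq0 ?gt_eqF // => -> //; last first.
  by move=> i; rewrite mxE invrK ltW.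
congr (fine (P' _) * _); apply/seteqP; split => w /open_coneE H; apply/open_coneE => i.
  by have := H i; rewrite /coords -scalemxAl !mxE pmulr_rgt0.
by have := H i; rewrite /coords -scalemxAl !mxE pmulr_rgt0.
Qed.

(* The constant is read off from any exponential vector, if there is one: it does
   not depend on the choice by [cone_prob_ratio_const]. *)
Lemma cone_prob_constant : exists kappa : R,
  forall d (T : measurableType d) (P : probability T R) (a : 'rV[R]_N) X,
    exponential_vector P a X -> cone_prob P X = kappa / cone_ratio a.
Proof.
have [[d [T [P [a [X XP]]]]]|no] := pselect (exists (d : measure_display)
    (T : measurableType d) (P : probability T R) (a : 'rV[R]_N) (X : T -> 'rV[R]_N),
    exponential_vector P a X); last first.
  by exists 0 => d T P a X XP; case: no; exists d, T, P, a, X.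
exists (cone_prob P X * cone_ratio a) => d' T' P' a' X' XP'.
have [a'0 _ _] := XP'; rewrite (cone_prob_ratio_const XP XP') mulfK //.
by rewrite gt_eqF // cone_ratio_gt0.
Qed.

(** Layer-cake formula: with [b] the rate of the coordinate, its tail on the cone is
    [cone_prob P X / b] times the exponential density of rate [b], whose total mass is 1. *)
Lemma cone_expectation d (T : measurableType d) (P : probability T R)
    (a : 'rV[R]_N) X i : exponential_vector P a X ->
  (\int[P]_(w in X @^-1` open_cone) (coords V g (X w) ord0 i)%:E =
   (cone_prob P X / cone_rates a ord0 i)%:E)%E.
Proof.
move=> XP; have [a0 _ _] := XP.
have b0 := cone_rates_gt0 a0 i; set b := cone_rates a ord0 i in b0 *.
(* Cut off outside the cone, the coordinate is nonnegative everywhere, and [Z > r] with [r >= 0] is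
   an orthant event for the cone coordinates. *)
pose Z w := coords V g (X w) ord0 i * \1_(X @^-1` open_cone) w.
have mC := measurable_preimage_cone XP.
have mZ : measurable_fun setT Z.
  apply: measurable_funM; first exact: measurable_cone_coords XP i.
  exact: measurable_indic.
have Z0 w : 0 <= Z w.
  rewrite /Z indicE; case: (boolP (w \in _)); rewrite ?mulr0 //.
  by rewrite inE => /forallP /(_ i) /ltW; rewrite mulr1.
pose Zm : {RV P >-> R} := mfun_Sub (mem_set mZ).
have := @ge0_expectation_ccdf _ _ _ P Zm Z0.
rewrite expectation_def /= => E.
transitivity (\int[P]_w (Z w)%:E)%E.
  rewrite [LHS]integral_mkcond; apply: eq_integral => w _.
  rewrite patchE /Z indicE; case: ifPn => _; by rewrite ?mulr1 ?mulr0.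
rewrite E.
transitivity (\int[lebesgue_measure]_(r in `[0%R, +oo[)
  ((cone_prob P X / b)%:E * (exponential_pdf b r)%:E))%E.
  apply: eq_integral => r; rewrite inE /= in_itv /= andbT => r0.
  have sE l : (r *: delta_mx ord0 i : 'rV[R]_N) ord0 l = if l == i then r else 0.
    by rewrite !mxE eqxx /=; case: eqVneq => _; rewrite ?mulr1 ?mulr0.
  have s0 l : 0 <= (r *: delta_mx ord0 i : 'rV[R]_N) ord0 l.
    by rewrite sE; case: ifP.
  have := cone_tails XP s0.
  have <- : Zm @^-1` `]r, +oo[%classic =
      (fun w => coords V g (X w)) @^-1` orthant (r *: delta_mx ord0 i).
    apply/seteqP; split => w /=; rewrite in_itv /= andbT /Z indicE.
      case: (boolP (w \in _)); last by rewrite mulr0 ltNge r0.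
      rewrite inE mulr1 => /forallP wC rY l; rewrite sE.
      by case: eqVneq => [->|_] //; exact: wC.
    move=> H; rewrite mem_set.
      by have := H i; rewrite sE eqxx mulr1.
    apply/forallP => l; have := H l; apply: le_lt_trans.
    exact: s0.
  rewrite /ccdf /distribution /pushforward => ->.
  have -> : dotr (cone_rates a) (r *: delta_mx ord0 i) = b * r.
    rewrite /dotr (bigD1 i) //= big1 ?addr0 => [|l /negPf li].
      by rewrite sE eqxx.
    by rewrite sE li mulr0.
  by rewrite exponential_pdfE // -EFinM mulrA divfK ?gt_eqF // mulNr.
apply: integral_scaled_exponential_pdf => //.
by rewrite divr_ge0 ?(ltW b0) // fine_ge0.
Qed.

End cone_probability.

(** * Rational functions with submatrix sums as denominators *)

Section rational.
Variables (R : realType) (k m n : nat).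
Hypotheses (le_km : (k <= m)%N) (le_kn : (k <= n)%N).
Notation poly := (mpoly.mpoly (m * n) R).
Notation lines := ({set 'I_m} * {set 'I_n})%type.

Definition positive_mx (A : 'M[R]_(m, n)) := forall i j, 0 < A i j.

Definition small_lines (D : seq lines) :=
  forall IJ, IJ \in D -> (#|IJ.1| + #|IJ.2| < k)%N.

Definition denominator (D : seq lines) (A : 'M[R]_(m, n)) : R :=
  \prod_(IJ <- D) submatrix_sum A IJ.1 IJ.2.

Definition rational_in_submatrices (F : 'M[R]_(m, n) -> R) : Prop :=
  exists (N : poly) (D : seq lines), small_lines D /\
    forall A, positive_mx A -> F A = eval_entries N A / denominator D A.

Lemma eval_entriesD (p q : poly) A :
  eval_entries (p + q) A = eval_entries p A + eval_entries q A.
Proof. exact: mpoly.mevalD. Qed.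

Lemma eval_entriesM (p q : poly) A :
  eval_entries (p * q) A = eval_entries p A * eval_entries q A.
Proof. exact: mpoly.mevalM. Qed.

(** Fewer than k omitted lines leave at least one row and one column. *)
Lemma submatrix_sum_gt0 A (IJ : lines) : positive_mx A ->
  (#|IJ.1| + #|IJ.2| < k)%N -> 0 < submatrix_sum A IJ.1 IJ.2.
Proof.
move=> A0 IJk; rewrite /submatrix_sum.
have [i iI] : exists i, i \in (~: IJ.1)%SET.
  apply/set0Pn; rewrite -card_gt0; have := cardsC IJ.1; rewrite card_ord; lia.
have [j jJ] : exists j, j \in (~: IJ.2)%SET.
  apply/set0Pn; rewrite -card_gt0; have := cardsC IJ.2; rewrite card_ord; lia.
rewrite (bigD1 i) //= ltr_pwDl //.
  by rewrite (bigD1 j) //= ltr_pwDl // sumr_ge0 // => j' _; exact: ltW.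
by apply: sumr_ge0 => i' _; apply: sumr_ge0 => j' _; exact: ltW.
Qed.

Lemma denominator_neq0 D A : small_lines D -> positive_mx A -> denominator D A != 0.
Proof.
move=> Dk A0; rewrite /denominator big_seq gt_eqF // prodr_gt0 // => IJ IJD.
by apply: submatrix_sum_gt0 => //; exact: Dk.
Qed.

Lemma denominator_poly D : exists N : poly, forall A, eval_entries N A = denominator D A.
Proof.
elim: D => [|[I J] D [N NP]].
  exists 1 => A; rewrite /denominator big_nil; exact: (rmorph1 (mpoly.meval _)).
pose S : poly := \sum_(i in ~: I) \sum_(j in ~: J) mpoly.mpolyX R (mpoly.mnm1 (mxvec_index i j)).
exists (S * N) => A; rewrite eval_entriesM NP /denominator big_cons; congr (_ * _).
rewrite /eval_entries /S (raddf_sum (mpoly.meval _)) /=; apply: eq_bigr => i _.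
rewrite (raddf_sum (mpoly.meval _)) /=; apply: eq_bigr => j _.
by rewrite mpoly.mevalXU mxvecE.
Qed.

Lemma rational_poly (N : poly) : rational_in_submatrices (fun A => eval_entries N A).
Proof. by exists N, [::]; split => // A _; rewrite /denominator big_nil divr1. Qed.

Lemma rational_const c : rational_in_submatrices (fun=> c).
Proof.
have [N [D [Dk E]]] := rational_poly (mpoly.mpolyC (m * n) c).
exists N, D; split => // A A0; rewrite -E //.
by rewrite /eval_entries mpoly.mevalC.
Qed.

Lemma rational_entry l : rational_in_submatrices (fun A => mxvec A ord0 l).
Proof.
have [N [D [Dk E]]] := rational_poly (mpoly.mpolyX R (mpoly.mnm1 l)).
exists N, D; split => // A A0; rewrite -E //.
by rewrite /eval_entries mpoly.mevalXU.
Qed.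

Lemma rationalV (IJ : lines) : (#|IJ.1| + #|IJ.2| < k)%N ->
  rational_in_submatrices (fun A => (submatrix_sum A IJ.1 IJ.2)^-1).
Proof.
move=> IJk; exists 1, [:: IJ]; split; first by move=> IJ'; rewrite inE => /eqP ->.
move=> A _; rewrite /denominator big_seq1 /eval_entries.
by rewrite (rmorph1 (mpoly.meval _)) mul1r.
Qed.

Lemma rationalM F G : rational_in_submatrices F -> rational_in_submatrices G ->
  rational_in_submatrices (fun A => F A * G A).
Proof.
case=> [N [D [Dk FE]]] [N' [D' [D'k GE]]]; exists (N * N'), (D ++ D'); split.
  by move=> IJ; rewrite mem_cat => /orP[/Dk|/D'k].
by move=> A A0; rewrite FE // GE // eval_entriesM /denominator big_cat mulf_div.
Qed.

Lemma rationalD F G : rational_in_submatrices F -> rational_in_submatrices G ->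
  rational_in_submatrices (fun A => F A + G A).
Proof.
case=> [N [D [Dk FE]]] [N' [D' [D'k GE]]].
have [Q QE] := denominator_poly D; have [Q' Q'E] := denominator_poly D'.
exists (N * Q' + N' * Q), (D ++ D'); split.
  by move=> IJ; rewrite mem_cat => /orP[/Dk|/D'k].
move=> A A0; rewrite FE // GE // eval_entriesD !eval_entriesM QE Q'E.
have -> : denominator (D ++ D') A = denominator D A * denominator D' A.
  by rewrite /denominator big_cat.
by rewrite addf_div //; exact: denominator_neq0.
Qed.

Lemma rational_sum (I : Type) (r : seq I) (Q : pred I) F :
  (forall i, Q i -> rational_in_submatrices (F i)) ->
  rational_in_submatrices (fun A => \sum_(i <- r | Q i) F i A).
Proof.
move=> FP; elim: r => [|i r IH].
  by under eq_fun do rewrite big_nil; exact: rational_const.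
under eq_fun do rewrite big_cons.
by case Qi: (Q i) => //; apply: rationalD => //; exact: FP.
Qed.

Lemma rational_prod (I : Type) (r : seq I) F :
  (forall i, rational_in_submatrices (F i)) ->
  rational_in_submatrices (fun A => \prod_(i <- r) F i A).
Proof.
move=> FP; elim: r => [|i r IH].
  by under eq_fun do rewrite big_nil; exact: rational_const.
by under eq_fun do rewrite big_cons; exact: rationalM.
Qed.

Lemma eq_rational F G : (forall A, positive_mx A -> F A = G A) ->
  rational_in_submatrices F -> rational_in_submatrices G.
Proof.
by move=> FG [N [D [Dk FE]]]; exists N, D; split => // A A0; rewrite -FG // FE.
Qed.

End rational.

(** * The minimum assignment *)

Lemma sum_mxvec (R : nmodType) (m n : nat) (F : 'I_(m * n) -> R) :
  \sum_l F l = \sum_i \sum_j F (mxvec_index i j).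
Proof.
rewrite pair_bigA (reindex _ (curry_mxvec_bij m n)) /=.
by apply: eq_bigr => -[i j].
Qed.

Section rays.
Variables (R : realType) (k m n : nat).
Hypotheses (k_gt0 : (0 < k)%N) (le_km : (k <= m)%N) (le_kn : (k <= n)%N).

Definition cover := {IJ : {set 'I_m} * {set 'I_n} | (#|IJ.1| + #|IJ.2| < k)%N}.
(** The generators of the linear program. Unit vectors absorb the slack at weight 0 and provide the
    starting basis of the simplex argument. *)
Definition ray := (cover + 'I_(m * n))%type.

Definition ray_vec (a : ray) : 'rV[R]_(m * n) :=
  match a with
  | inl IJ => mxvec (submatrix_mask R (val IJ).1 (val IJ).2)
  | inr l => delta_mx ord0 l
  end.

Definition ray_weight (a : ray) : R :=
  match a with
  | inl IJ => (k - (#|(val IJ).1| + #|(val IJ).2|))%:R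
  | inr _ => 0
  end.

Lemma ray_vec_ge0 a l : 0 <= ray_vec a ord0 l.
Proof.
case: a => [IJ|l'] /=; last by rewrite mxE ler0n.
by case/mxvec_indexP: l => i j; rewrite mxvecE mxE ler0n.
Qed.

Lemma dotr_ray (A : 'M[R]_(m, n)) a : dotr (mxvec A) (ray_vec a) =
  match a with
  | inl IJ => submatrix_sum A (val IJ).1 (val IJ).2
  | inr l => mxvec A ord0 l
  end.
Proof.
rewrite /dotr; case: a => [IJ|l] /=; last first.
  rewrite (bigD1 l) //= mxE !eqxx mulr1 big1 ?addr0 // => l' /negPf l'l.
  by rewrite mxE l'l andbF mulr0.
rewrite sum_mxvec /submatrix_sum [RHS]big_mkcond /=; apply: eq_bigr => i _.
rewrite [X in _ = if _ then X else _]big_mkcond /=.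
case: ifPn => iI; last first.
  rewrite big1 // => j _; rewrite !mxvecE mxE; move: iI.
  by rewrite finset.in_setC negbK => ->; rewrite mulr0.
apply: eq_bigr => j _; rewrite !mxvecE mxE; move: iI.
rewrite !finset.in_setC => -> /=.
by case: ifP => _; rewrite ?mulr1 ?mulr0.
Qed.

Lemma ray_vec_neq0 a : ray_vec a != 0.
Proof.
pose A : 'M[R]_(m, n) := const_mx 1.
have A0 : positive_mx A by move=> i j; rewrite mxE ltr01.
apply: contraTneq isT => a0.
have := dotr_ray A a; rewrite a0 /dotr big1 => [|l _]; last by rewrite mxE mulr0.
case: {a0} a => [IJ|l] e.
  by have := submatrix_sum_gt0 le_km le_kn A0 (valP IJ); rewrite -e ltxx.
move: e; case/mxvec_indexP: l => i j; rewrite mxvecE mxE => /esym/eqP.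
by rewrite oner_eq0.
Qed.

Lemma cost_sum (I : finType) (c : I -> R) (y : I -> 'rV[R]_(m * n)) S :
  cost (vec_mx (\sum_i c i *: y i)) S = \sum_i c i * cost (vec_mx (y i)) S.
Proof.
rewrite /cost; under [RHS]eq_bigr do rewrite mulr_sumr.
rewrite exchange_big; apply: eq_bigr => p _ /=; rewrite mxE summxE.
by apply: eq_bigr => i _; rewrite !mxE.
Qed.

Lemma ray_weight_le_cost a S : is_assignment k S ->
  ray_weight a <= cost (vec_mx (ray_vec a)) S.
Proof.
case: a => [IJ|l] Sk /=; first by rewrite mxvecK; exact: cost_submatrix_mask.
by apply: sumr_ge0 => p _; rewrite !mxE ler0n.
Qed.

Lemma row_sum_delta_ord0 (x : 'rV[R]_(m * n)) :
  x = \sum_l x ord0 l *: delta_mx ord0 l.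
Proof. exact: row_sum_delta. Qed.

(** Costs are linear in the matrix and dominate the weight of each generator, which bounds min_k
    from below. Above, the dual solution read as a matrix of prices satisfies all cut conditions. *)
Lemma min_assignment_cone (g : {ffun 'I_(m * n) -> ray}) x :
  gens ray_vec g \in unitmx ->
  (forall a, ray_weight a <= lp ray_vec ray_weight g (ray_vec a)) ->
  in_cone ray_vec g x ->
  min_assignment k (vec_mx x) =
    \sum_i coords ray_vec g x ord0 i * ray_weight (g i).
Proof.
move=> gu feas gx; have [[S Sk SE] _] := min_assignmentP (vec_mx x) le_km le_kn.
apply/eqP; rewrite eq_le; apply/andP; split; last first.
  rewrite SE -[x in cost (vec_mx x)](coordsK x gu) gens_sum cost_sum.
  apply: ler_sum => i _; apply: ler_wpM2l; last exact: ray_weight_le_cost.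
  by rewrite ltW // (forallP gx).
rewrite -/(lp ray_vec ray_weight g x).
have x0 : forall l, 0 < x ord0 l.
  have := @open_cone_gt0 R (m * n) ray ray_vec ray_vec_ge0 g gu x gx.
  by move=> H l; have := H l; rewrite mxE.
(* Dual feasibility at unit vectors says [p >= 0], and at the covers it is the cut condition. *)
pose p : 'M[R]_(m, n) :=
  \matrix_(i, j) lp ray_vec ray_weight g (delta_mx ord0 (mxvec_index i j)).
have lpx y : lp ray_vec ray_weight g y =
    \sum_i \sum_j p i j * y ord0 (mxvec_index i j).
  rewrite {1}(row_sum_delta_ord0 y) lp_sum sum_mxvec.
  by apply: eq_bigr => i _; apply: eq_bigr => j _; rewrite mxE mulrC.
rewrite lpx.
rewrite (eq_bigr (fun i => \sum_j p i j * vec_mx x i j)); last first.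
  by move=> i _; apply: eq_bigr => j _; rewrite !mxE.
apply: min_assignment_le_cut => //.
- by move=> i j; rewrite mxE; exact: (feas (inr (mxvec_index i j))).
- by move=> i j; rewrite mxE ltW.
move=> I J IJk; pose c : cover := exist _ (I, J) IJk.
apply: le_trans (feas (inl c)) _; rewrite /= lpx /submatrix_sum.
rewrite [leRHS]big_mkcond; apply: ler_sum => i _.
case: ifPn => iI; last first.
  rewrite big1 // => j _; rewrite mxvecE [submatrix_mask _ _ _ _ _]mxE.
  by move: iI; rewrite finset.in_setC negbK => ->; rewrite mulr0.
rewrite [leRHS]big_mkcond; apply: ler_sum => j _.
rewrite mxvecE [submatrix_mask _ _ _ _ _]mxE; move: iI.
by rewrite !finset.in_setC => -> /=; case: ifP => _; rewrite ?mulr1 ?mulr0.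
Qed.

Lemma ray_partition : exists C : {set {ffun 'I_(m * n) -> ray}},
  (forall g, g \in C -> gens ray_vec g \in unitmx) /\
  forall x : 'rV[R]_(m * n), (forall l, 0 < x ord0 l) -> generic ray_vec x ->
    min_assignment k (vec_mx x) = \sum_(g in C) \sum_i
      ray_weight (g i) * (coords ray_vec g x ord0 i * (in_cone ray_vec g x)%:R).
Proof.
have [C [CP Cx]] := cone_partition ray_vec_ge0 ray_vec_neq0
  (unit_gen := fun l => inr l) (fun l => erefl) ray_weight.
exists C; split => [g /CP[] //|x x0 xg].
have [g [gC gx] guniq] := Cx x x0 xg; have [gu gf] := CP g gC.
rewrite (bigD1 g) //= [X in _ + X]big1 ?addr0 => [|h /andP[hC hg]].
  rewrite (min_assignment_cone gu gf gx); apply: eq_bigr => i _.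
  by rewrite gx mulr1 mulrC.
rewrite big1 // => i _; case: (boolP (in_cone ray_vec h x)) => [hx|_].
  by rewrite (guniq h) // eqxx in hg.
by rewrite !mulr0.
Qed.

End rays.

(** * Expectation over the cones *)

(** Only finitely many walls are to be avoided, each the kernel of a column of an inverse matrix,
    which is nonzero. *)
Lemma exponential_vector_generic (R : realType) (N : nat) (J : finType)
    (V : J -> 'rV[R]_N) d (T : measurableType d) (P : probability T R) a X :
  exponential_vector P a X ->
  {ae P, forall w, orthant 0 (X w) /\ generic V (X w)}.
Proof.
move=> XP; have mX := measurable_exponential_vector XP.
have ae0 : {ae P, forall w, orthant 0 (X w)}.
  exists (~` (X @^-1` orthant 0)); split => //.
    by apply: measurableC; apply: (measurable_preimage XP); exact: measurable_orthant.
  rewrite probability_setC; last by apply: (measurable_preimage XP); exact: measurable_orthant.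
  by rewrite (exponential_vector_gt0 XP) subee.
suff aeg : {ae P, forall w, generic V (X w)}.
  by apply: filterS2 ae0 aeg => w; split.
have : forall gi : {ffun 'I_N -> J} * 'I_N,
    {ae P, forall w, gens V gi.1 \in unitmx -> coords V gi.1 (X w) ord0 gi.2 != 0}.
  case=> g i /=; have [gu|_] := boolP (gens V g \in unitmx); last first.
    by apply: filterE => w.
  pose c l := invmx (gens V g) l i.
  have c0 : exists l, c l != 0.
    apply/existsP; apply: contraT; rewrite negb_exists => /forallP c0.
    have := mulmxV gu => /matrixP/(_ i i); rewrite !mxE eqxx big1.
      by move=> /eqP; rewrite eq_sym oner_eq0.
    by move=> l _; have := c0 l; rewrite negbK /c => /eqP ->; rewrite mulr0.
  have null : {ae P, forall w, ~ (orthant 0 (X w) /\ \sum_l X w ord0 l * c l = 0)}.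
    exists (X @^-1` orthant 0 `&` [set w | \sum_l X w ord0 l * c l = 0]); split.
    - apply: measurableI; first by apply: (measurable_preimage XP); exact: measurable_orthant.
      pose E : set (vecT R N) := [set x | \sum_i (x : 'rV[R]_N) ord0 i * c i = 0].
      have mE : measurable E.
        have := measurable_linear c measurableT (measurable_set1 0).
        by rewrite setTI; congr measurable; apply/seteqP.
      exact: (measurable_preimage XP mE).
    - exact: (hyperplane_null XP c0).
    - by move=> w /= /contrapT.
  apply: filterS2 ae0 null => w w0 wn _; apply/eqP => w1; apply: wn; split => //.
  by rewrite -[RHS]w1 [RHS]mxE.
move=> /filter_forall; apply: filterS => w H g gu i; exact: (H (g, i)).
Qed.

Section expectation.
Variables (R : realType) (k m n : nat).
Hypotheses (le_km : (k <= m)%N) (le_kn : (k <= n)%N).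
Variables (A : 'M[R]_(m, n)) (d : measure_display) (T : measurableType d)
  (P : probability T R) (X : 'I_m -> 'I_n -> {RV P >-> R}).
Hypotheses (A_gt0 : positive_mx A) (XP : random_exponential_matrix A X).

Definition sample w : 'M[R]_(m, n) := \matrix_(i, j) X i j w.

Lemma exponential_vector_sample :
  exponential_vector P (mxvec A) (fun w => mxvec (sample w)).
Proof.
have [indep law] := XP; split.
- by case/mxvec_indexP => i j; rewrite mxvecE.
- case/mxvec_indexP => i j; under eq_fun do rewrite mxvecE mxE.
  exact: measurable_funP.
move=> s s0.
pose B (p : 'I_m * 'I_n) : set R := `]s ord0 (mxvec_index p.1 p.2), +oo[%classic.
have mB p : measurable (B p) by exact: measurable_itv.
have := indep [set: 'I_m * 'I_n]%SET B mB.
have -> : \bigcap_(i in [set` [set: 'I_m * 'I_n]%SET]) (X i.1 i.2 @^-1` B i) =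
    (fun w => mxvec (sample w)) @^-1` orthant s.
  apply/seteqP; split => w /=.
    move=> H; case/mxvec_indexP => i j; rewrite mxvecE mxE.
    by have := H (i, j); rewrite /= inE /B /= in_itv /= andbT; apply.
  move=> H [i j] _; rewrite /B /= in_itv /= andbT.
  by have := H (mxvec_index i j); rewrite mxvecE mxE.
move=> ->; transitivity (\prod_(p : 'I_m * 'I_n)
    (expR (- A p.1 p.2 * s ord0 (mxvec_index p.1 p.2)))%:E)%E.
  rewrite big_mkcond; apply: eq_bigr => -[i j] _; rewrite inE /=.
  transitivity (distribution P (X i j) (B (i, j))); first by [].
  by rewrite (law i j _ (mB _)) exponential_prob_itvoy.
rewrite prodEFin -expR_sum; congr (expR _)%:E.
rewrite /dotr sum_mxvec pair_bigA -sumrN; apply: eq_bigr => -[i j] _ /=.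
by rewrite mxvecE mulNr.
Qed.

(** The minimum exceeds r exactly when each of finitely many costs does; measurability of the
    minimiser is never at issue. *)
Lemma measurable_min_assignment :
  measurable_fun setT (fun w => min_assignment k (sample w)).
Proof.
apply: (measurability _ (RGenOInfty.measurableE R)).
move=> _ [_ [r ->] <-]; rewrite setTI.
have -> : (fun w => min_assignment k (sample w)) @^-1` `]r, +oo[%classic =
    [set w | forall S : {set 'I_m * 'I_n}, is_assignment k S -> r < cost (sample w) S].
  apply/seteqP; split => w /=; rewrite in_itv /= andbT.
    move=> rw S Sk; apply: lt_le_trans rw _.
    exact: (proj2 (min_assignmentP _ le_km le_kn)).
  by have [[S Sk ->] _] := min_assignmentP (sample w) le_km le_kn; apply.
apply: measurable_forall => S; case: (is_assignment k S); last first.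
  by rewrite (_ : [set w | _] = setT) //; apply/seteqP; split.
rewrite (_ : [set w | _] = [set w | r < cost (sample w) S]); last first.
  by apply/seteqP; split => w /=; [apply|].
apply: measurable_gt; rewrite /cost.
under eq_fun do rewrite big_mkcond.
apply: measurable_sum => p; case: (p \in S) => //.
by under eq_fun do rewrite mxE; exact: measurable_funP.
Qed.

Lemma expectation_min_assignment (C : {set {ffun 'I_(m * n) -> ray k m n}}) :
  (forall g, g \in C -> gens (@ray_vec R k m n) g \in unitmx) ->
  (forall x : 'rV[R]_(m * n), (forall l, 0 < x ord0 l) -> generic (@ray_vec R k m n) x ->
    min_assignment k (vec_mx x) = \sum_(g in C) \sum_i
      ray_weight R (g i) * (coords (@ray_vec R k m n) g x ord0 i *
        (in_cone (@ray_vec R k m n) g x)%:R)) ->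
  ('E_P[fun w => min_assignment k (sample w)] =
   (\sum_(g in C) \sum_i ray_weight R (g i) *
     (cone_prob (@ray_vec R k m n) g P (fun w => mxvec (sample w)) /
      cone_rates (@ray_vec R k m n) g (mxvec A) ord0 i))%:E)%E.
Proof.
set V := @ray_vec R k m n; move=> Cu Cx; have YP := exponential_vector_sample.
set Y := fun w => mxvec (sample w); rewrite -/Y in YP.
rewrite unlock.
pose h (g : {ffun 'I_(m * n) -> ray k m n}) i w := ray_weight R (g i) * (coords V g (Y w) ord0 i * (in_cone V g (Y w))%:R).
have mh g i : gens V g \in unitmx -> measurable_fun setT (h g i).
  move=> gu; apply: measurable_funM => //; apply: measurable_funM.
    exact: (measurable_cone_coords V g YP).
  have -> : (fun w => (in_cone V g (Y w))%:R) = \1_(Y @^-1` open_cone V g) :> (T -> R).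
    apply/funext => w; rewrite indicE; congr (nat_of_bool _)%:R.
    by apply/idP/idP; rewrite inE.
  exact: measurable_indic (measurable_preimage_cone V g YP).
have h0 g i w : gens V g \in unitmx -> 0 <= h g i w.
  move=> gu; rewrite /h; case: (boolP (in_cone V g (Y w))) => [/forallP H|_].
    rewrite mulr1 mulr_ge0 ?(ltW (H i)) // /ray_weight.
    by case: (g i) => // ?; exact: ler0n.
  by rewrite !mulr0.
(* Outside [C] the matrix of generators may be singular, so measurability and sign of [h] are known
   only on [C]. *)
pose H g w := if g \in C then \sum_i h g i w else 0.
have mH g : measurable_fun setT (fun w => (H g w)%:E).
  apply/measurable_EFinP; rewrite /H; case gC: (g \in C); last exact: measurable_cst.
  by apply: measurable_sum => i; apply: mh; exact: Cu.
transitivity (\int[P]_w (\sum_g (H g w)%:E))%E.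
  apply: ae_eq_integral => //.
  - by apply/measurable_EFinP; exact: measurable_min_assignment.
  - by apply: emeasurable_sum => g; exact: mH.
  apply: filterS (exponential_vector_generic V YP) => w [w0 wg] _.
  rewrite -[sample w]mxvecK (Cx _ _ wg); last by move=> l; have := w0 l; rewrite mxE.
  by rewrite big_mkcond sumEFin.
rewrite ge0_integral_sum //; last first.
  move=> g w _; rewrite lee_fin /H; case: ifP => // gC.
  by apply: sumr_ge0 => i _; apply: h0; exact: Cu.
transitivity (\sum_(g in C) \int[P]_w (\sum_i (h g i w)%:E))%E.
  rewrite [RHS]big_mkcond; apply: eq_bigr => g _; rewrite /H; case: (g \in C).
    by apply: eq_integral => w _; rewrite sumEFin.
  by rewrite integral0.
rewrite -sumEFin; apply: eq_bigr => g gC; have gu := Cu g gC.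
rewrite ge0_integral_sum //; last 2 first.
- by move=> i; apply/measurable_EFinP; exact: mh.
- by move=> i w _; rewrite lee_fin h0.
rewrite -sumEFin; apply: eq_bigr => i _.
rewrite EFinM -(cone_expectation (@ray_vec_ge0 R k m n) gu i YP).
rewrite -ge0_integralZl //; last 4 first.
- exact: (measurable_preimage_cone V g YP).
- apply/measurable_EFinP; apply: measurable_funTS.
  exact: (measurable_cone_coords V g YP).
- by move=> w /forallP wg; rewrite lee_fin ltW.
- by rewrite lee_fin; case: (g i) => // ?; exact: ler0n.
rewrite [RHS]integral_mkcond; apply: eq_integral => w _.
rewrite patchE /h; case: ifPn => [|wg].
  by rewrite inE /= => wg; rewrite /open_cone /= in wg; rewrite wg mulr1 EFinM.
have -> : in_cone V g (Y w) = false.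
  by apply: contraNF wg => wg; rewrite inE.
by rewrite mulr0 mulr0.
Qed.

End expectation.

(* The rates of the generators e_l cancel against the product of all entries. *)
Lemma rational_inv_cone_ratio (R : realType) (k m n : nat)
    (g : {ffun 'I_(m * n) -> ray k m n}) : (k <= m)%N -> (k <= n)%N ->
  gens (@ray_vec R k m n) g \in unitmx ->
  rational_in_submatrices k
    (fun A : 'M[R]_(m, n) => (cone_ratio (@ray_vec R k m n) g (mxvec A))^-1).
Proof.
move=> le_km le_kn gu; set V := @ray_vec R k m n.
(* If the unit vector of index l is a generator, it is exactly one of them, [g] being injective.
   [free] collects the entries left in the numerator after cancellation. *)
pose used l := [exists i, g i == inr l].
pose free (A : 'M[R]_(m, n)) := \prod_l (if used l then 1 else mxvec A ord0 l).
pose sums (A : 'M[R]_(m, n)) := \prod_i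
  (if g i is inl IJ then (submatrix_sum A (val IJ).1 (val IJ).2)^-1 else 1).
apply: (@eq_rational R k m n (fun A => free A * sums A)); last first.
  apply: rationalM; apply: rational_prod => x.
    by case: (used x); [exact: rational_const|exact: rational_entry].
  by case: (g x) => [IJ|_]; [exact: rationalV (valP IJ)|exact: rational_const].
move=> A A0; have a0 l : 0 < mxvec A ord0 l.
  by case/mxvec_indexP: l => i j; rewrite mxvecE.
have usedE : \prod_i (if g i is inr l then mxvec A ord0 l else 1) =
    \prod_l (if used l then mxvec A ord0 l else 1).
  transitivity (\prod_i \prod_(l | g i == inr l) mxvec A ord0 l).
    apply: eq_bigr => i _; case: (g i) => [IJ|l]; first by rewrite big_pred0 // => l; apply/eqP.
    by rewrite (big_pred1 l) // => l'; apply/eqP/eqP => [[]|->].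
  rewrite (exchange_big_dep xpredT) //=; apply: eq_bigr => l _.
  rewrite /used; case: (boolP [exists i, g i == inr l]) => [/existsP[i /eqP gi]|].
    rewrite (big_pred1 i) // => j; rewrite -gi.
    by rewrite (inj_eq (gens_inj gu)).
  by rewrite negb_exists => /forallP gl; rewrite big_pred0 // => i; exact: negbTE (gl i).
have -> : cone_ratio V g (mxvec A) = (free A * sums A)^-1.
  rewrite /cone_ratio.
  have -> : \prod_i cone_rates V g (mxvec A) ord0 i =
      (\prod_i (if g i is inl IJ then submatrix_sum A (val IJ).1 (val IJ).2 else 1)) *
      \prod_l (if used l then mxvec A ord0 l else 1).
    rewrite -usedE -big_split; apply: eq_bigr => i _ /=; rewrite mxE dotr_ray.
    by case: (g i) => ?; rewrite ?mulr1 ?mul1r.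
  have -> : \prod_l mxvec A ord0 l =
      free A * \prod_l (if used l then mxvec A ord0 l else 1).
    by rewrite -big_split; apply: eq_bigr => l _ /=; case: (used l); rewrite ?mulr1 ?mul1r.
  rewrite -mulf_div divff ?mulr1; last first.
    by rewrite gt_eqF // prodr_gt0 // => l _; case: ifP.
  rewrite invfM mulrC; congr (_ * _); rewrite /sums -prodfV; apply: eq_bigr => i _.
  by case: (g i) => ?; rewrite ?invrK ?invr1.
by rewrite invrK.
Qed.

Theorem theorem2 (R : realType) (k m n : nat) (k_gt0 : (0 < k)%N)
    (le_km : (k <= m)%N) (le_mn : (m <= n)%N) :
  exists (N : mpoly.mpoly (m * n) R) (D : seq ({set 'I_m} * {set 'I_n})),
    (forall IJ, IJ \in D -> (#|IJ.1| + #|IJ.2| < k)%N) /\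
    forall A : 'M[R]_(m, n), (forall i j, 0 < A i j) ->
    forall (d : measure_display) (T : measurableType d) (P : probability T R)
      (X : 'I_m -> 'I_n -> {RV P >-> R}),
      random_exponential_matrix A X ->
      ('E_P[fun w => min_assignment k (\matrix_(i, j) X i j w)] =
       (eval_entries N A / \prod_(IJ <- D) submatrix_sum A IJ.1 IJ.2)%:E)%E.
Proof.
have le_kn : (k <= n)%N by exact: leq_trans le_mn.
have [C [Cu Cx]] := @ray_partition R k m n k_gt0 le_km le_kn.
pose V := @ray_vec R k m n.
(* The constants are fixed before the matrix and the probability space, as the numerator must not
   depend on these. *)
have /fin_all_exists[kappa kappaP] g : exists c : R, g \in C ->
    forall d (T : measurableType d) (P : probability T R) a X,
      exponential_vector P a X -> cone_prob V g P X = c / cone_ratio V g a.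
  case: (boolP (g \in C)) => [gC|_]; last by exists 0.
  by have [c cP] := cone_prob_constant (@ray_vec_ge0 R k m n) (Cu g gC); exists c.
pose F (A : 'M[R]_(m, n)) := \sum_(g in C) \sum_i ray_weight R (g i) *
  (kappa g / cone_ratio V g (mxvec A) / cone_rates V g (mxvec A) ord0 i).
have [N [D [Dk FE]]] : rational_in_submatrices k F.
  apply: rational_sum => // g gC; apply: rational_sum => // i _.
  (* For a unit vector the mean would contribute a single entry as denominator; its weight 0 removes
     the term. *)
  case gi : (g i) => [IJ|l] /=; last first.
    by under eq_fun do rewrite mul0r; exact: rational_const.
  apply: rationalM; first exact: rational_const.
  apply: rationalM.
    apply: rationalM; first exact: rational_const.
    exact: rational_inv_cone_ratio (Cu g gC).
  by under eq_fun do rewrite mxE dotr_ray gi; exact: rationalV (valP IJ).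
exists N, D; split => // A A0 d T P X XP.
rewrite -[eval_entries N A / _]FE //.
rewrite (expectation_min_assignment le_km le_kn A0 XP Cu Cx).
have YP := exponential_vector_sample A0 XP.
congr EFin; apply: eq_bigr => g gC; apply: eq_bigr => i _.
by rewrite (kappaP g gC _ _ _ _ _ YP).
Qed.
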